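(* Let $d\geq 3$ be an integer, let $M = \mathbb{S}^1(\tfrac{1}{\sqrt{d-2}}) \times \mathbb{S}^{d-1}(1)$ with its standard product metric $g$, and let $q=\frac{2d}{d-2}$. Then the following hold. (i) In the statement ''for every sequence $(u_n)\subset H^1(M)$ of nonconstant functions with $\|u_n\|^2=Y$ and $\|u_n\|_q\to 1$ one has $\liminf_{n\to\infty} \frac{\| u_n\|^2 ( \|u_n\|^2 - Y\|u_n\|_q^2)}{\| u_n -\overline{u_n}\|^4} \geq \frac{(q+2)(q-2)}{12(q-1)}$'', the constant on the right side cannot be replaced by a larger one. (ii) The power four is best possible: for any $\alpha<4$ there is no constant $c>0$ such that $\|u\|^2 - Y\|u\|_q^2 \geq c\, \|u\|^{2-\alpha}\,\|u-\overline u\|^{\alpha}$ for all nonconstant $u\in H^1(M)$.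
   Context: All functions are real-valued. $\mathbb{S}^n(r)\subset\mathbb{R}^{n+1}$ denotes the $n$-dimensional sphere of radius $r>0$; $dv_g$ is the Riemannian volume measure of $(M,g)$ and $\mathrm{Vol}_g(M)=\int_M dv_g$. Notation: $\|u\|^2 := \int_M \left( |\nabla_g u|_g^2 + \frac{(d-2)^2}{4} u^2 \right)dv_g$, $\|u\|_q := \left(\int_M |u|^q\,dv_g\right)^{1/q}$, $\overline u := (\mathrm{Vol}_g(M))^{-1}\int_M u\,dv_g$, and $Y := \frac{(d-2)^2}{4} \left( \mathrm{Vol}_g(M) \right)^{2/d}$. *)

(* Defs.v *)
From HB Require Import structures.
From mathcomp Require Import all_boot all_order all_algebra.
From mathcomp Require Import all_classical all_reals all_analysis.
From mathcomp Require Import measurable_realfun lebesgue_measure.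
Set Implicit Arguments.
Unset Strict Implicit.
Unset Printing Implicit Defensive.
Import Order.TTheory GRing.Theory Num.Theory.
Import numFieldNormedType.Exports.
Local Open Scope classical_set_scope.
Local Open Scope ring_scope.

(* The sigma-algebra on R^n generated by the coordinates; it is the Borel one. *)
Definition rV_display : measure_display. Proof. exact: (default_measure_display). Qed.

Section measurable_rV.
Context {R : realType} {n : nat}.

Let coord (i : 'I_n) (x : 'rV[R]_n) : R := x ord0 i.

Let rV_set0 : g_sigma_preimage coord set0.
Proof. exact: sigma_algebra0. Qed.

Let rV_setC A : g_sigma_preimage coord A -> g_sigma_preimage coord (~` A).
Proof. exact: sigma_algebraC. Qed.

Let rV_bigcup (F : (set 'rV[R]_n)^nat) :
  (forall i, g_sigma_preimage coord (F i)) ->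
  g_sigma_preimage coord (\bigcup_i (F i)).
Proof. exact: sigma_algebra_bigcup. Qed.

HB.instance Definition _ := @isMeasurable.Build rV_display
  'rV[R]_n (g_sigma_preimage coord) rV_set0 rV_setC rV_bigcup.

Lemma measurable_rV_coord (i : 'I_n) :
  measurable_fun [set: 'rV[R]_n] (fun x => x ord0 i).
Proof.
move=> _ Y mY; rewrite setTI; apply: sub_sigma_algebra => /=.
rewrite -bigcup_seq/=; exists i => /=; first by rewrite mem_index_enum.
by exists Y => //; rewrite setTI.
Qed.

Lemma measurable_fun_rVP d (T : measurableType d) (f : T -> 'rV[R]_n) :
  (forall i, measurable_fun [set: T] (fun x => f x ord0 i)) ->
  measurable_fun [set: T] f.
Proof.
move=> mf; apply: (measurability
  (\big[setU/set0]_(i < n) preimage_set_system setT (coord i) measurable)) => //.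
move=> _ [A + <-]; rewrite -bigcup_seq => -[i _] [B mB <-].
rewrite [_ `&` (coord i @^-1` B)]setTI -comp_preimage.
exact: (mf i measurableT B mB).
Qed.

End measurable_rV.

Section spheres.
Context {R : realType}.

Definition dot n (x y : 'rV[R]_n) : R := \sum_(i < n) x ord0 i * y ord0 i.

Definition sphere n (r : R) : set 'rV[R]_n.+1 := [set x | dot x x = r ^+ 2].

(* sin^n(t) dt on [0, pi]; sin t >= 0 there, and the absolute value makes the
   density nonnegative everywhere *)
Definition polar_measure n (A : set R) : \bar R :=
  (\int[mrestr lebesgue_measure (measurable_itv `[0%R, pi : R])]_(t in A)
     (`|sin t| ^+ n)%:E)%E.

Let polar0 n : polar_measure n set0 = 0%E.
Proof. by rewrite /polar_measure integral_set0. Qed.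

Let polar_ge0 n A : (0 <= polar_measure n A)%E.
Proof. by apply: integral_ge0 => x _; rewrite lee_fin exprn_ge0. Qed.

Let polar_sadd n : semi_sigma_additive (@polar_measure n).
Proof.
apply: (@semi_sigma_additive_nng_induced _ _ _ (mrestr lebesgue_measure (measurable_itv `[0%R, pi : R]))
  (fun t => (`|sin t| ^+ n)%:E)) => [|x]; last first.
  by rewrite lee_fin exprn_ge0.
apply/measurable_EFinP; apply: measurable_funX; apply: measurableT_comp => //.
by apply: continuous_measurable_fun; exact: continuous_sin.
Qed.

HB.instance Definition _ n := isMeasure.Build _ _ _ (@polar_measure n)
  (@polar0 n) (@polar_ge0 n) (@polar_sadd n).

Let polar_fin n : (polar_measure n setT < +oo)%E.
Proof.
apply: (@le_lt_trans _ _ 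
  (\int[mrestr lebesgue_measure (measurable_itv `[0%R, pi : R])]_(t in setT)
     (cst 1 t))%E).
  apply: ge0_le_integral => //=.
  - apply/measurable_EFinP; apply: measurable_funX; apply: measurableT_comp => //.
    by apply: continuous_measurable_fun; exact: continuous_sin.
  - move=> x _; rewrite lee_fin exprn_ile1// ler_norml.
    by rewrite sin_geN1 sin_le1.
rewrite integral_cst// mul1e [ltLHS]/= /mrestr setTI lebesgue_measure_itv/=.
by case: ifPn => _; rewrite ?ltry// oppr0 ltry.
Qed.

(* Geodesic polar coordinates (0, pi) x S^n -> S^(n+1), which miss only the two
   poles.  In them the round metric is dt^2 + sin^2 t g_(S^n), so sqrt(det g)
   gives dv_(S^(n+1)) = sin^n t dt dv_(S^n). *)
Definition polar n (p : R * 'rV[R]_n.+1) : 'rV[R]_n.+2 :=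
  row_mx (cos p.1)%:M (sin p.1 *: p.2) : 'rV[R]_(1 + n.+1).

Lemma measurable_polar n : measurable_fun setT (@polar n).
Proof.
have mcos : measurable_fun setT (@cos R).
  by apply: continuous_measurable_fun; exact: continuous_cos.
have msin : measurable_fun setT (@sin R).
  by apply: continuous_measurable_fun; exact: continuous_sin.
apply: measurable_fun_rVP => i; rewrite /polar.
have [j ij|j ij] := splitP (i : 'I_(1 + n.+1)).
  have -> : i = lshift n.+1 j by exact: val_inj.
  rewrite (_ : (fun _ => _) = (@cos R) \o fst); first exact: measurableT_comp.
  apply/funext => x; apply: etrans (row_mxEl _ _ _ _) _.
  by rewrite mxE !ord1 eqxx mulr1n.
have -> : i = rshift 1 j by exact: val_inj.
rewrite (_ : (fun _ => _) =
  fun x : R * 'rV[R]_n.+1 => sin x.1 * x.2 ord0 j); last first.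
  by apply/funext => x; apply: etrans (row_mxEr _ _ _ _) _; rewrite mxE.
apply: measurable_funM; first exact: measurableT_comp.
exact: (measurableT_comp (measurable_rV_coord j)).
Qed.

HB.instance Definition _ n :=
  isMeasurableFun.Build _ _ _ _ (@polar n) (@measurable_polar n).

Section step.
Variables (n : nat) (m : {finite_measure set 'rV[R]_n.+1 -> \bar R}).

Definition polar_vol : set 'rV[R]_n.+2 -> \bar R :=
  pushforward (polar_measure n \x m)%E (@polar n).

Let mf := @measurable_polar n.

Let polar_vol0 : polar_vol set0 = 0%E.
Proof. exact: measure0. Qed.

Let polar_vol_ge0 A : (0 <= polar_vol A)%E.
Proof. exact: measure_ge0. Qed.

Let polar_vol_sadd : semi_sigma_additive polar_vol.
Proof. exact: measure_semi_sigma_additive. Qed.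

HB.instance Definition _ := isMeasure.Build _ _ _ polar_vol
  polar_vol0 polar_vol_ge0 polar_vol_sadd.

Let polar_vol_fin : fin_num_fun polar_vol.
Proof.
apply: lty_fin_num_fun; rewrite /= /polar_vol /pushforward preimage_setT.
rewrite /product_measure1.
under eq_integral do rewrite /= xsectionE preimage_setT.
rewrite integral_cst//; apply: lte_mul_pinfty => //.
  by rewrite fin_num_measure.
exact: polar_fin.
Qed.

HB.instance Definition _ := Measure_isFinite.Build _ _ _ polar_vol polar_vol_fin.
End step.

(* S^0 = {1, -1} with the counting measure *)
Definition vol_S0 : set 'rV[R]_1 -> \bar R :=
  measure_add (\d_(1%:M : 'rV[R]_1)) (\d_((-1)%:M : 'rV[R]_1)).

HB.instance Definition _ := Measure.on vol_S0.

Let vol_S0_fin : fin_num_fun vol_S0.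
Proof.
apply: lty_fin_num_fun => /=; rewrite [ltLHS]measure_addE.
by rewrite lte_add_pinfty//= diracE ltry.
Qed.

HB.instance Definition _ := Measure_isFinite.Build _ _ _ vol_S0 vol_S0_fin.

(* Riemannian volume of S^n(1), carried by [sphere n 1] *)
Fixpoint vol_unit_sphere n : {finite_measure set 'rV[R]_n.+1 -> \bar R} :=
  match n with
  | 0 => vol_S0
  | k.+1 => polar_vol (vol_unit_sphere k)
  end.

Lemma measurable_scale n (r : R) :
  measurable_fun [set: 'rV[R]_n] (fun x => r *: x).
Proof.
apply: measurable_fun_rVP => i.
rewrite (_ : (fun _ => _) = fun x : 'rV[R]_n => r * x ord0 i).
  by apply: measurable_funM => //; exact: measurable_rV_coord.
by apply/funext => x; rewrite mxE.
Qed.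

Section dilation.
Variables (n : nat) (r : R).

Definition vol_dilated : set 'rV[R]_n.+1 -> \bar R :=
  pushforward (vol_unit_sphere n) (fun x => r *: x).

Let mf := @measurable_scale n.+1 r.

Let vol_dilated0 : vol_dilated set0 = 0%E.
Proof. exact: measure0. Qed.

Let vol_dilated_ge0 A : (0 <= vol_dilated A)%E.
Proof. exact: measure_ge0. Qed.

Let vol_dilated_sadd : semi_sigma_additive vol_dilated.
Proof. exact: measure_semi_sigma_additive. Qed.

HB.instance Definition _ := isMeasure.Build _ _ _ vol_dilated
  vol_dilated0 vol_dilated_ge0 vol_dilated_sadd.

Let vol_dilated_fin : fin_num_fun vol_dilated.
Proof.
apply: lty_fin_num_fun; rewrite /= /vol_dilated /pushforward preimage_setT.
by rewrite fin_num_fun_lty//; exact: fin_num_measure.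
Qed.

HB.instance Definition _ :=
  Measure_isFinite.Build _ _ _ vol_dilated vol_dilated_fin.

(* Riemannian volume of S^n(r), r > 0: dilating by r multiplies the metric by
   r^2, hence the n-dimensional volume by r^n. *)
Definition vol_sphere : {finite_measure set 'rV[R]_n.+1 -> \bar R} :=
  mscale (`|r| ^+ n)%:nng vol_dilated.

End dilation.

End spheres.

Section manifold.
Context {R : realType}.

(* C^k, by iterated directional derivatives *)
Fixpoint Ck (V : normedModType R) k (f : V -> R) : Prop :=
  match k with
  | 0 => continuous f
  | l.+1 => forall v, (forall x, derivable f x v) /\ Ck l (fun x => 'D_v f x)
  end.

Definition smooth (V : normedModType R) (f : V -> R) := forall k, Ck k f.

Variable d : nat.

Definition radius : R := (Num.sqrt (d%:R - 2))^-1.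

Local Notation E := ('rV[R]_2 * 'rV[R]_d.-1.+1)%type.

(* S^1(radius) x S^(d-1)(1) in R^2 x R^d; 'rV_d.-1.+1 is R^d for d > 0 *)
Definition M : set E := @sphere R 1 radius `*` @sphere R d.-1 1.

(* The Riemannian volume of a product metric is the product of the volumes. *)
Definition vol : {measure set E -> \bar R} :=
  (vol_sphere 1 radius \x vol_sphere d.-1 1)%E.

Definition VolM : R := fine (vol M).

Definition sqnorm (v : E) : R := dot v.1 v.1 + dot v.2 v.2.

(* orthogonal projection of v onto the tangent space at x of the sphere
   centered at 0 through x *)
Definition tproj n (x v : 'rV[R]_n) : 'rV[R]_n :=
  v - (dot v x / dot x x) *: x.

(* The product metric is induced by R^2 x R^d, so the Riemannian gradient of
   f restricted to M is the tangential part of the Euclidean gradient of f. *)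
Definition grad (f : E -> R) (z : E) : E :=
  (tproj z.1 (\row_i 'D_(delta_mx ord0 i, 0) f z),
   tproj z.2 (\row_i 'D_(0, delta_mx ord0 i) f z)).

(* H^1(M) as the completion of C^oo(M), realized as the closure in L^2 x L^2 of
   the pairs (phi, grad phi).  As M is a compact embedded submanifold, C^oo(M)
   consists of the restrictions of smooth functions on R^2 x R^d.  Functions
   are defined on the ambient space but only their values on M matter.  That
   u and its gradient are square integrable follows from the approximation, as
   M is compact; the gradient is determined vol-a.e. by u since the gradient
   is closable. *)
Record H1 := MkH1 {
  H1fun :> E -> R ;
  H1grad : E -> E ;
  H1_measurable : measurable_fun M H1fun ;
  H1grad_measurable : measurable_fun M H1grad ;
  H1_approx : exists phi : nat -> E -> R,
    [/\ forall k, smooth (phi k),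
     (\int[vol]_(z in M) ((phi k z - H1fun z) ^+ 2)%:E)%E @[k --> \oo] --> 0%E
   & (\int[vol]_(z in M) (sqnorm (grad (phi k) z - H1grad z))%:E)%E
       @[k --> \oo] --> 0%E]
}.

Lemma diff_quotient_subc (V : normedModType R) (f : V -> R) (c : R) (x v : V) :
  (fun h : R => h^-1 *: (((fun y => f y - c) \o shift x) (h *: v) - (f x - c)))
  = (fun h : R => h^-1 *: ((f \o shift x) (h *: v) - f x)).
Proof.
by apply/funext => h /=; rewrite opprB addrA subrK.
Qed.

Lemma derive_subc (V : normedModType R) (f : V -> R) (c : R) (x v : V) :
  'D_v (fun y => f y - c) x = 'D_v f x.
Proof. by rewrite /derive diff_quotient_subc. Qed.

Lemma smooth_subc (V : normedModType R) (f : V -> R) (c : R) :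
  smooth f -> smooth (fun x => f x - c).
Proof.
move=> sf [|k] /=.
  by move=> x; apply: cvgB; [exact: (sf 0%N)|exact: cvg_cst].
move=> v; have [df Cf] := sf k.+1 v; split.
  by move=> x; rewrite /derivable diff_quotient_subc; exact: df.
by under eq_fun do rewrite derive_subc.
Qed.

Lemma grad_subc (f : E -> R) (c : R) : grad (fun z => f z - c) = grad f.
Proof.
apply/funext => z; rewrite /grad; congr (tproj _ _, tproj _ _);
  by apply/rowP => i; rewrite !mxE derive_subc.
Qed.

Section sub_cst.
Variables (u : H1) (c : R).

Let u_measurable : measurable_fun M (fun z => u z - c).
Proof. by apply: measurable_funB => //; exact: H1_measurable. Qed.

Let u_approx : exists phi : nat -> E -> R,
  [/\ forall k, smooth (phi k),
     (\int[vol]_(z in M) ((phi k z - (u z - c)) ^+ 2)%:E)%E @[k --> \oo] --> 0%E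
   & (\int[vol]_(z in M) (sqnorm (grad (phi k) z - H1grad u z))%:E)%E
       @[k --> \oo] --> 0%E].
Proof.
have [phi [sphi phiu gphiu]] := H1_approx u.
exists (fun k z => phi k z - c); split.
- by move=> k; exact: smooth_subc.
- under eq_fun => k.
    under eq_integral => z _ do rewrite opprB addrA subrK.
    over.
  exact: phiu.
- under eq_fun => k do rewrite grad_subc.
  exact: gphiu.
Qed.

(* [u - c], with gradient [grad u] *)
Definition H1_subc : H1 :=
  MkH1 u_measurable (H1grad_measurable u) u_approx.

End sub_cst.

(* elements of H^1(M) are classes modulo vol-a.e. equality *)
Definition nonconstant (u : H1) : Prop :=
  ~ exists c : R, {ae vol, forall z, M z -> u z = c}.

Definition norm_H1 (u : H1) : R :=
  Num.sqrt (\int[vol]_(z in M)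
    (sqnorm (H1grad u z) + (d%:R - 2) ^+ 2 / 4 * u z ^+ 2)).

(* finite for 1 <= q <= 2d/(d-2) by the Sobolev embedding *)
Definition norm_Lq (q : R) (u : H1) : R :=
  (\int[vol]_(z in M) (`|u z| `^ q)) `^ q^-1.

Definition mean (u : H1) : R := VolM^-1 * \int[vol]_(z in M) u z.

Definition Y : R := (d%:R - 2) ^+ 2 / 4 * VolM `^ (2 / d%:R).

End manifold.

Arguments H1 R d : clear implicits.
Arguments Y R d : clear implicits.

(* Main.v *)
Require Import Defs.
From mathcomp Require Import all_boot all_order all_algebra.
From mathcomp Require Import all_classical all_reals all_analysis.
From mathcomp Require Import measurable_realfun lebesgue_measure.
From mathcomp Require Import ring lra.
Import Order.TTheory GRing.Theory Num.Theory.
Import numFieldNormedType.Exports.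
Local Open Scope classical_set_scope.
Local Open Scope ring_scope.

Set Implicit Arguments.
Unset Strict Implicit.
Unset Printing Implicit Defensive.

(** The statement is proved by an explicit family of test functions depending
    only on the angle [theta] of the circle factor.  Write [V] for the volume of
    [M], [A = (d-2)^2/4], [|u|] for the H^1 norm and [|u|_q] for the L^q norm.
    The circle has radius [1/sqrt(d-2)], so [cos theta] is an eigenfunction of
    the Laplacian with eigenvalue
    [d - 2 = A (q - 2)].  This is exactly the value at which the second
    variation of [|u|^2 - Y |u|_q^2] at the constants vanishes, so that along
    [1 + eps cos theta + ...] the functional is of order [eps^4], while
    [|u - mean u|^2] is of order [eps^2].  This already excludes every power
    [alpha < 4].

    For the constant, the perturbation is corrected at second order:
    [u = lam (1 + eps cos theta + eps^2 b cos (2 theta))].  With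
    [S = 1 + (q-1)/2 eps^2 + (4q-7)/2 b^2 eps^4] and [N] the average of
    [|u / lam|^q], one has exactly [|u|^2 = A V lam^2 S],
    [|u - mean u|^2 = A V lam^2 (S - 1)] and
    [Y |u|_q^2 = A V lam^2 N^(2/q)], whence the quotient of the statement
    equals [S (S - N^(2/q)) / (S - 1)^2].  Expanding, [S - N^(2/q)] is [eps^4]
    times a quadratic polynomial in [b] up to higher order; it is smallest for
    [b = (q-1)/12], with minimum [(q-1)(q-2)(q+2)/48], and the quotient then
    tends to [(q+2)(q-2)/(12(q-1))].

    Three ingredients carry the proof.  [Rintegral_cos_angle] reduces the
    integral over [M] of a function of [cos theta] to an integral over
    [[0, pi]], where only the moments of [cos theta] up to order four are needed
    ([avg_poly4]).  [taylor_powR] bounds the remainder of the binomial series of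
    a real power, and yields the expansion of [N] in [Lq_avg_expansion] and that
    of [N^(2/q)] in [cvg_defect].  The functions of [cos theta] used here are
    polynomials in a linear form on the ambient space, so they are smooth, hence
    in H^1, and have an explicit gradient ([zonal]). *)

(** * The volume of the spheres *)

Section sphere_measure.
Context {R : realType}.

Lemma measurable_sphere n (r : R) : measurable (@sphere R n r).
Proof.
have md : measurable_fun [set: 'rV[R]_n.+1] (fun x => dot x x).
  apply: measurable_sum => i.
  by apply: measurable_funM; exact: measurable_rV_coord.
rewrite -[sphere r]setTI.
exact: (md measurableT [set r ^+ 2] (measurable_set1 _)).
Qed.

Lemma polar0E n (p : R * 'rV[R]_n.+1) : polar p ord0 ord0 = cos p.1.
Proof.
have -> : ord0 = lshift n.+1 (ord0 : 'I_1) :> 'I_n.+2 by exact: val_inj.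
by apply: etrans (row_mxEl _ _ _ _) _; rewrite mxE eqxx mulr1n.
Qed.

Lemma polarSE n (p : R * 'rV[R]_n.+1) (i : 'I_n.+1) :
  polar p ord0 (lift ord0 i) = sin p.1 * p.2 ord0 i.
Proof.
have -> : lift ord0 i = rshift 1 i :> 'I_n.+2 by exact: val_inj.
by apply: etrans (row_mxEr _ _ _ _) _; rewrite mxE.
Qed.

Lemma dot_polar n (p : R * 'rV[R]_n.+1) :
  dot (polar p) (polar p) = cos p.1 ^+ 2 + sin p.1 ^+ 2 * dot p.2 p.2.
Proof.
rewrite /dot big_ord_recl polar0E expr2 big_distrr/=; congr (_ + _).
by apply: eq_bigr => i _; rewrite polarSE expr2 mulrACA.
Qed.

Lemma polar_sphere n (p : R * 'rV[R]_n.+1) :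
  sphere 1 p.2 -> sphere 1 (polar p).
Proof.
by rewrite /sphere/= dot_polar => ->; rewrite expr1n mulr1 cos2Dsin2.
Qed.

Lemma polar_measure0E (A : set R) : measurable A ->
  polar_measure 0 A = lebesgue_measure (A `&` `[0%R, pi : R]).
Proof.
move=> mA; rewrite /polar_measure.
under eq_integral do rewrite expr0.
by rewrite integral_cst// mul1e.
Qed.

Lemma polar_measureT_gt0 n : (0 < @polar_measure R n setT)%E.
Proof.
rewrite lt_neqAle measure_ge0 andbT; apply/eqP => /esym pm0.
set m := mrestr lebesgue_measure (measurable_itv `[0%R, pi : R]).
have mf : measurable_fun setT (fun t : R => (`|sin t| ^+ n)%:E).
  apply/measurable_EFinP; apply: measurable_funX; apply: measurableT_comp => //.
  by apply: continuous_measurable_fun; exact: continuous_sin.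
have : (\int[m]_(t in setT) `|(`|sin t| ^+ n)%:E| = 0)%E.
  rewrite -[RHS]pm0; apply: eq_integral => t _.
  by rewrite gee0_abs// lee_fin exprn_ge0.
move/(ae_eq_integral_abs m measurableT mf) => [N [mN N0 sub]].
have : (m `]0%R, pi[%classic <= 0)%E.
  rewrite -N0; apply: le_measure; rewrite ?inE// => t /=.
  rewrite in_itv/= => tpi.
  apply: sub => /= /(_ I) [] /eqP; rewrite expf_eq0 normr_eq0 => /andP[_].
  by rewrite gt_eqF// sin_gt0_pi.
rewrite /m /= /mrestr.
rewrite setIidl; last first.
  by move=> t /=; rewrite !in_itv/= => /andP[? ?]; rewrite !ltW.
rewrite lebesgue_measure_itv/= lte_fin pi_gt0 oppr0 adde0.
by rewrite leNgt lte_fin pi_gt0.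
Qed.

Lemma vol_S0E (A : set 'rV[R]_1) : vol_S0 A =
  (((1%:M : 'rV[R]_1) \in A)%:R + (((-1)%:M : 'rV[R]_1) \in A)%:R)%:E.
Proof. by rewrite [LHS]measure_addE /= /dirac !indicE. Qed.

(** The volume of the unit sphere, defined on the ambient space, is carried by
    the sphere: polar coordinates over [S^n] take values in [S^(n+1)]. *)
Lemma vol_unit_sphereC n : vol_unit_sphere n (~` @sphere R n 1) = 0%E.
Proof.
elim: n => [|n IH].
  have s0 (a : R) : a ^+ 2 = 1 -> @sphere R 0 1 (a%:M : 'rV[R]_1).
    move=> a2; rewrite /sphere/= /dot big_ord1 mxE eqxx mulr1n -expr2 a2.
    by rewrite expr1n.
  rewrite [LHS]vol_S0E.
  have sN (a : R) : a ^+ 2 = 1 ->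
      (a%:M : 'rV[R]_1) \in ~` @sphere R 0 1 = false.
    by move=> a2; apply/negbTE; rewrite notin_setE/= => /(_ (s0 _ a2)).
  by rewrite !sN ?sqrrN ?expr1n// addr0.
apply/eqP; rewrite eq_le measure_ge0 andbT.
have mS := @measurable_sphere n 1.
have P0 : (polar_measure n \x vol_unit_sphere n)%E
    (setT `*` ~` @sphere R n 1) = 0%E.
  by rewrite product_measure1E//= ?IH ?mule0//; exact: measurableC.
rewrite /= /polar_vol /pushforward -P0; apply: le_measure; rewrite ?inE.
- rewrite -[X in measurable X]setTI; apply: measurable_polar => //.
  by apply: measurableC; exact: measurable_sphere.
- by apply: measurableX => //; exact: measurableC.
- by move=> p /= h; split=> // sp; apply: h; exact: polar_sphere.
Qed.

Lemma vol_unit_sphereT_gt0 n : (0 < @vol_unit_sphere R n setT)%E.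
Proof.
elim: n => [|n IH].
  by rewrite [ltRHS]vol_S0E !in_setT/= lte_fin.
rewrite /= /polar_vol /pushforward preimage_setT -setXTT.
rewrite product_measure1E// mule_gt0//; exact: polar_measureT_gt0.
Qed.

(** The law of the first coordinate on the unit circle: each of the two
    half-circles contributes the image of [dt] on [[0, pi]] under [cos]. *)
Lemma vol_unit_sphere1 (B : set R) : measurable B ->
  vol_unit_sphere 1 [set x : 'rV[R]_2 | B (x ord0 ord0)] =
  (2%:E * lebesgue_measure ((cos @^-1` B) `&` `[0%R, pi : R]))%E.
Proof.
move=> mB; rewrite /= /polar_vol /pushforward /product_measure1.
have mc : measurable (@cos R @^-1` B).
  rewrite -[X in measurable X]setTI.
  exact: (continuous_measurable_fun (@continuous_cos R)).
rewrite -polar_measure0E//.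
under eq_integral => t _.
  have -> : (vol_S0 \o
      xsection (polar (n:=0) @^-1` [set x | B (x ord0 ord0)])) t =
      (2%:E * (\1_(cos @^-1` B) t)%:E)%E.
    rewrite /= [LHS]vol_S0E !indicE !xsectionE/=.
    have E v : (v \in [set x : 'rV[R]_1 |
        (polar (n:=0) @^-1` [set x | B (x ord0 ord0)]) (t, x)]) =
        (t \in cos @^-1` B).
      by apply/idP/idP => /[!inE]/=; rewrite polar0E.
    by rewrite !E -EFinM; case: (_ \in _) => /=; rewrite ?mulr0 ?addr0 ?mulr1.
  over.
rewrite ge0_integralZl//; last first.
  by apply/measurable_EFinP; exact: measurable_indic.
by rewrite integral_indic// setIT.
Qed.

Lemma vol_sphereE n (r : R) (A : set 'rV[R]_n.+1) :
  vol_sphere n r A =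
  ((`|r| ^+ n)%:E * vol_unit_sphere n [set x | A (r *: x)])%E.
Proof. by []. Qed.

Lemma dotZ n (r : R) (x : 'rV[R]_n) : dot (r *: x) (r *: x) = r ^+ 2 * dot x x.
Proof.
by rewrite /dot big_distrr/=; apply: eq_bigr => i _; rewrite !mxE expr2 mulrACA.
Qed.

Lemma vol_sphereC n (r : R) : vol_sphere n r (~` @sphere R n r) = 0%E.
Proof.
rewrite vol_sphereE; apply/eqP; rewrite mule_eq0; apply/orP; right.
rewrite eq_le measure_ge0 andbT -(vol_unit_sphereC n).
have mS s := measurableC (@measurable_sphere n s).
apply: le_measure; rewrite ?inE.
- rewrite -[X in measurable X]setTI.
  by apply: measurable_scale => //; exact: mS.
- exact: mS.
- move=> x /= h s1; apply: h; rewrite /sphere/= dotZ.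
  by move: s1; rewrite /sphere/= => ->; rewrite expr1n mulr1.
Qed.

Lemma vol_sphereT_gt0 n (r : R) : 0 < r -> (0 < vol_sphere n r setT)%E.
Proof.
move=> r0; rewrite vol_sphereE mule_gt0// ?lte_fin.
  by rewrite exprn_gt0// normr_gt0 gt_eqF.
rewrite (_ : [set _ | _] = setT); first exact: vol_unit_sphereT_gt0.
by apply/seteqP; split.
Qed.

Lemma vol_sphere1 (r : R) (B : set R) : 0 < r -> measurable B ->
  vol_sphere 1 r [set x : 'rV[R]_2 | B (r^-1 * x ord0 ord0)] =
  ((2 * r)%:E * lebesgue_measure ((cos @^-1` B) `&` `[0%R, pi : R]))%E.
Proof.
move=> r0 mB; rewrite vol_sphereE expr1 gtr0_norm// [2 * r]mulrC EFinM -muleA.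
congr (_ * _)%E; rewrite -vol_unit_sphere1//; congr (vol_unit_sphere 1 _).
apply/seteqP; split=> x /=; rewrite mxE mulKf// gt_eqF//.
Qed.

End sphere_measure.

(** * Integrals over M of functions of the angle on the circle *)

Section latitude.
Context {R : realType} (d : nat).
Hypothesis hd : (3 <= d)%N.

Local Notation E := ('rV[R]_2 * 'rV[R]_d.-1.+1)%type.
Local Notation leb := (@lebesgue_measure R).
Local Notation I := `[0%R, pi : R]%classic.

Lemma dB2_gt0 : 0 < d%:R - 2 :> R.
Proof. by rewrite subr_gt0 ltr_nat. Qed.

Lemma radius_gt0 : 0 < Defs.radius d :> R.
Proof. by rewrite invr_gt0 sqrtr_gt0 dB2_gt0. Qed.

(** On [M] this is [cos theta], where [theta] is the angle on the circle
    factor; on the ambient space it is a linear form. *)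
Definition cos_angle (z : E) : R := (Defs.radius d)^-1 * z.1 ord0 ord0.

Lemma measurable_cos_angle : measurable_fun setT cos_angle.
Proof.
apply: measurable_funM => //.
exact: (measurableT_comp (measurable_rV_coord ord0)).
Qed.

Lemma measurable_M : measurable (@M R d).
Proof. by apply: measurableX; exact: measurable_sphere. Qed.

(* The image of the volume under [cos_angle] is [K] times the image of [dt] on
   [[0, pi]] under [cos]. *)
Let K : R := 2 * Defs.radius d * fine (@vol_sphere R d.-1 1 setT).

Let K_gt0 : 0 < K.
Proof.
rewrite mulr_gt0//; first by rewrite mulr_gt0// radius_gt0.
apply: fine_gt0; rewrite vol_sphereT_gt0//=.
by rewrite -ge0_fin_numE// fin_num_measure.
Qed.

Let vol_cos_angle (B : set R) : measurable B ->
  vol d (cos_angle @^-1` B) = (K%:E * leb ((cos @^-1` B) `&` I))%E.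
Proof.
move=> mB.
have -> : cos_angle @^-1` B =
    [set x : 'rV[R]_2 | B ((Defs.radius d)^-1 * x ord0 ord0)] `*` setT.
  by apply/seteqP; split=> z //= -[].
rewrite [LHS]product_measure1E//; last first.
  rewrite -[X in measurable X]setTI.
  have : measurable_fun setT
      (fun x : 'rV[R]_2 => (Defs.radius d)^-1 * x ord0 ord0).
    by apply: measurable_funM => //; exact: measurable_rV_coord.
  by apply.
rewrite [X in (X * _)%E](vol_sphere1 radius_gt0 mB).
rewrite muleAC; congr (_ * _)%E.
rewrite /K [RHS]EFinM; congr (_ * _)%E; apply/esym/fineK.
exact: fin_num_measure.
Qed.

Lemma volC : vol d (~` @M R d) = 0%E.
Proof.
apply/eqP; rewrite eq_le measure_ge0 andbT.
have m1 := measurableC (@measurable_sphere R 1 (Defs.radius d)).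
have m2 := measurableC (@measurable_sphere R d.-1 1).
set N1 := (~` @sphere R 1 (Defs.radius d)) `*` [set: 'rV[R]_d.-1.+1].
set N2 := [set: 'rV[R]_2] `*` (~` @sphere R d.-1 1).
have N10 : vol d N1 = 0%E.
  by rewrite [LHS]product_measure1E// [X in (X * _)%E]vol_sphereC mul0e.
have N20 : vol d N2 = 0%E.
  by rewrite [LHS]product_measure1E// [X in (_ * X)%E]vol_sphereC mule0.
apply: (@le_trans _ _ (vol d (N1 `|` N2))); last first.
  rewrite (le_trans (measureU2 _ _ _))//; try exact: measurableX.
  rewrite -[leRHS](adde0 0%E); apply: leeD.
    by move: (lexx (0 : \bar R)%E); rewrite -{1}N10.
  by move: (lexx (0 : \bar R)%E); rewrite -{1}N20.
apply: le_measure; rewrite ?inE.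
- by apply: measurableC; exact: measurable_M.
- by apply: measurableU; exact: measurableX.
- move=> z /= nM.
  have [s1|s1] := pselect (sphere (Defs.radius d) z.1); last by left.
  by right; split=> // s2; apply: nM.
Qed.

Let ge0_integral_M (G : R -> \bar R) : measurable_fun setT G ->
  (forall x, (0 <= G x)%E) ->
  (\int[vol d]_(z in @M R d) G (cos_angle z) =
   K%:E * \int[leb]_(t in I) G (cos t))%E.
Proof.
move=> mG G0.
have mGL : measurable_fun setT (G \o cos_angle).
  by apply: measurableT_comp => //; exact: measurable_cos_angle.
have mcos : measurable_fun setT (@cos R).
  by apply: continuous_measurable_fun; exact: continuous_cos.
have mI : measurable I by exact: measurable_itv.
have M0 := volC.
have mMC := measurableC measurable_M.
have -> : (\int[vol d]_(z in @M R d) G (cos_angle z) =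
           \int[vol d]_(z in setT) (G \o cos_angle) z)%E.
  rewrite [RHS](ge0_negligible_integral mMC)//; first by rewrite setTD setCK.
  by move=> z _; exact: G0.
have mcos_angle := measurable_cos_angle.
(* [m0] is [dt] on [[0, pi]]; [m2] and [m3] are two forms of the image of the
   volume under [cos_angle]. *)
pose m0 : {measure set (measurableTypeR R) -> \bar R} := mrestr leb mI.
have mcos' : measurable_fun (setT : set (measurableTypeR R)) (@cos R) := mcos.
pose m1 : {measure set R -> \bar R} :=
  measure_function_pushforward__canonical__measure_function_Measure m0 mcos'.
pose m2 : {measure set R -> \bar R} := mscale (NngNum (ltW K_gt0)) m1.
pose m3 : {measure set R -> \bar R} :=
  measure_function_pushforward__canonical__measure_function_Measure
    (vol d) mcos_angle.
have -> : (\int[vol d]_(z in setT) (G \o cos_angle) z =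
    \int[m3]_(y in setT) G y)%E.
  by rewrite [RHS]ge0_integral_pushforward.
have -> : (\int[m3]_(y in setT) G y = \int[m2]_(y in setT) G y)%E.
  apply: eq_measure_integral => B mB _; exact: vol_cos_angle.
rewrite [LHS]ge0_integral_mscale//=; congr (_ * _)%E.
have mIC := measurableC mI.
rewrite [LHS]ge0_integral_pushforward//= preimage_setT.
rewrite (@ge0_negligible_integral _ _ _ m0 setT (~` I))//.
- rewrite setTD setCK; apply: eq_measure_integral => B mB BI.
  by rewrite /m0/= /mrestr setIidl.
- by move: (measurableT_comp mG mcos').
- by rewrite /m0/= /mrestr setICl measure0.
Qed.

Let mI : measurable I. Proof. exact: measurable_itv. Qed.

Lemma integrable_cos (G : R -> R) : continuous G ->
  leb.-integrable I (EFin \o (G \o cos)).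
Proof.
move=> cG; apply: (@continuous_compact_integrable R (G \o cos) I).
  exact: segment_compact.
apply: continuous_subspaceT => x; apply: continuous_comp.
  exact: continuous_cos.
exact: cG.
Qed.

Lemma integrable_cos_angle (G : R -> R) : continuous G ->
  (vol d).-integrable (@M R d) (EFin \o (G \o cos_angle)).
Proof.
move=> cG; have mG : measurable_fun setT G by exact: continuous_measurable_fun.
apply/integrableP; split.
  apply/measurable_EFinP; apply: measurable_funTS.
  apply: measurableT_comp => //.
  exact: measurable_cos_angle.
rewrite (@ge0_integral_M (fun x => `|(G x)%:E|)%E)//; last first.
  by apply: measurableT_comp => //; exact/measurable_EFinP.
rewrite lte_mul_pinfty ?lee_fin//; first exact: ltW.
by have /integrableP[_] := integrable_cos cG.
Qed.

Let integral_M (G : R -> R) : continuous G ->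
  (\int[vol d]_(z in @M R d) (G (cos_angle z))%:E =
   K%:E * \int[leb]_(t in I) (G (cos t))%:E)%E.
Proof.
move=> cG; have mG : measurable_fun setT (EFin \o G).
  by apply/measurable_EFinP; exact: continuous_measurable_fun.
rewrite [LHS]integralE [in RHS]integralE.
rewrite muleBr//; last exact: integrable_add_def (integrable_cos cG).
have P T (h : T -> R) :
    ((fun x => (G (h x))%:E)^\+ = (EFin \o G)^\+ \o h)%E.
  by apply/funext => x; rewrite -funepos_comp.
have N T (h : T -> R) :
    ((fun x => (G (h x))%:E)^\- = (EFin \o G)^\- \o h)%E.
  by apply/funext => x; rewrite -funeneg_comp.
rewrite (P _ cos_angle) (P _ cos) (N _ cos_angle) (N _ cos); congr (_ - _)%E.
  exact: (@ge0_integral_M (EFin \o G)^\+%E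
    (measurable_funepos mG) (funepos_ge0 _)).
exact: (@ge0_integral_M (EFin \o G)^\-%E
    (measurable_funeneg mG) (funeneg_ge0 _)).
Qed.

Let VolME : VolM d = K * pi.
Proof.
rewrite /VolM (_ : vol d (@M R d) = K%:E * pi%:E)%E//.
have cG : continuous (cst 1 : R -> R) by move=> x; exact: cvg_cst.
have := integral_M cG; rewrite /= !integral_cst//; last exact: measurable_M.
rewrite !mul1e => ->; congr (_ * _)%E.
by apply: etrans (lebesgue_measure_itv _) _; rewrite /= lte_fin pi_gt0 sube0.
Qed.

Lemma VolM_gt0 : 0 < VolM d :> R.
Proof. by rewrite VolME mulr_gt0// pi_gt0. Qed.

(** The average of [G (cos theta)] over the circle.  As [cos] is even, half of
    the circle suffices. *)
Definition avg (G : R -> R) : R := pi^-1 * \int[leb]_(t in I) G (cos t).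

(** Integration over [M] of a function of the angle reduces to one variable. *)
Lemma Rintegral_cos_angle (G : R -> R) : continuous G ->
  \int[vol d]_(z in @M R d) G (cos_angle z) = VolM d * avg G.
Proof.
move=> cG; rewrite /avg VolME mulrA mulfK ?gt_eqF ?pi_gt0//.
rewrite /Rintegral integral_M// fineM//.
by apply: integrable_fin_num => //; exact: integrable_cos.
Qed.

End latitude.

(** * Averages over the circle *)

Section averages.
Context {R : realType}.
Local Notation leb := (@lebesgue_measure R).
Local Notation I := `[0%R, pi : R]%classic.

Lemma continuous_normr_powR (p : R) : 1 <= p ->
  continuous (fun x : R => `|x| `^ p).
Proof.
move=> p1 x; have [->|x0] := eqVneq x 0.
  have p0 : p != 0 by rewrite gt_eqF// (lt_le_trans _ p1).
  suff : `|y| `^ p @[y --> (0 : R)] --> (0 : R).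
    by rewrite /continuous_at normr0 powR0.
  apply/cvgr0Pnorm_le => e e0; near=> y.
  rewrite ger0_norm ?powR_ge0//.
  have ye : `|y| <= e by near: y; exact: (@nbhs0_le R R).
  have y1 : `|y| <= 1 by near: y; exact: (@nbhs0_le R R).
  have [->|y0] := eqVneq y 0; first by rewrite normr0 powR0// ltW.
  by rewrite (le_trans (ge1r_powR _ p1))// y1 normr_gt0 y0.
have : {for `|x|, continuous (fun y : R => y `^ p)}.
  apply/differentiable_continuous/derivable1_diffP.
  by apply: derivable_powR; rewrite in_itv/= normr_gt0 x0.
apply: (cvg_comp (fun y : R => `|y|) (fun y : R => y `^ p)) => //.
exact: norm_continuous.
Unshelve. all: by end_near. Qed.

Let mI : measurable (I : set (measurableTypeR R)).
Proof. exact: measurable_itv. Qed.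

Lemma avg_dist (F G : R -> R) (e : R) : continuous F -> continuous G ->
  (forall c, `|c| <= 1 -> `|F c - G c| <= e) -> `|avg F - avg G| <= e.
Proof.
move=> cF cG FG; have ip : 0 < pi^-1 :> R by rewrite invr_gt0 pi_gt0.
have cFG : continuous (F \- G) by move=> x; apply: cvgB; [exact: cF|exact: cG].
rewrite /avg -mulrBr -RintegralB//; [|exact: integrable_cos..].
rewrite normrM gtr0_norm// ler_pdivrMl ?pi_gt0//.
apply: le_trans.
  by apply: le_normr_Rintegral => //; exact: (integrable_cos cFG).
have ce : continuous (cst e : R -> R) by move=> x; exact: cvg_cst.
apply: (@le_trans _ _ (\int[leb]_(t in I) e)).
  apply: le_Rintegral => //.
  - have := integrable_cos
      (fun x => continuous_comp (cFG x) (@norm_continuous _ _ _)).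
    exact.
  - exact: integrable_cos ce.
  - by move=> t _; apply: FG; rewrite ler_norml cos_geN1 cos_le1.
rewrite Rintegral_cst// mulrC.
rewrite (_ : fine _ = pi)//.
apply: etrans (congr1 fine (lebesgue_measure_itv _)) _.
by rewrite /= lte_fin pi_gt0/= subr0.
Qed.

Lemma avgZ (k : R) (f : R -> R) : continuous f ->
  avg (fun c => k * f c) = k * avg f.
Proof.
move=> cf; rewrite /avg mulrCA; congr (_ * _).
by apply: RintegralZl => //; exact: integrable_cos.
Qed.

(** The moments of [cos theta] of order 1 to 4 are 0, 1/2, 0 and 3/8. *)
Lemma avg_poly4 (a0 a1 a2 a3 a4 : R) :
  avg (fun c => a0 + a1 * c + a2 * c ^+ 2 + a3 * c ^+ 3 + a4 * c ^+ 4) =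
  a0 + a2 / 2 + a4 * (3 / 8).
Proof.
pose f t : R := a0 + a1 * cos t + a2 * cos t ^+ 2 + a3 * cos t ^+ 3
  + a4 * cos t ^+ 4.
pose F : R -> R := (a0 + a2 / 2 + a4 * (3 / 8)) *: id
  + (a1 + a3 * (2 / 3)) *: sin
  + (a2 / 2 + a4 * (3 / 8)) *: (sin * cos)
  + (a3 / 3) *: (sin * cos ^+ 2) + (a4 / 4) *: (sin * cos ^+ 3).
have dF (t : R) : is_derive t (1:R) F (f t).
  have ds := is_derive_sin t; have dc := is_derive_cos t.
  have di : is_derive t (1:R) (@id R) 1 by exact: is_derive_id.
  have d2 : is_derive t (1:R) (cos ^+ 2 : R -> R) _ := is_deriveX 2 dc.
  have d3 : is_derive t (1:R) (cos ^+ 3 : R -> R) _ := is_deriveX 3 dc.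
  have H := is_deriveD (is_deriveD (is_deriveD (is_deriveD
    (is_deriveZ (a0 + a2 / 2 + a4 * (3 / 8)) di)
    (is_deriveZ (a1 + a3 * (2 / 3)) ds))
    (is_deriveZ (a2 / 2 + a4 * (3 / 8)) (is_deriveM ds dc)))
    (is_deriveZ (a3 / 3) (is_deriveM ds d2)))
    (is_deriveZ (a4 / 4) (is_deriveM ds d3)).
  apply: (is_derive_eq H).
  rewrite !exprfctE /f /GRing.scale/=.
  have -> : cos t * cos t = cos t ^+ 2 by rewrite expr2.
  (* [f] is the derivative of [F] modulo [cos^2 + sin^2 = 1]. *)
  transitivity (f t - (cos t ^+ 2 + sin t ^+ 2 - 1) *
    (a2 / 2 + a4 * (3 / 8) + a3 / 3 * 2 * cos t + a4 / 4 * 3 * cos t ^+ 2)).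
    by rewrite /f; field.
  by rewrite cos2Dsin2 subrr mul0r subr0.
have cF : continuous F.
  by move=> t; apply/differentiable_continuous/derivable1_diffP; case: (dF t).
have cf : continuous f.
  move=> t; rewrite /f.
  have cc := @continuous_cos R t.
  by repeat (apply: cvgD || apply: cvgM || apply: cvg_cst || exact: cc).
rewrite /avg /Rintegral (@continuous_FTC2 R f F)//; first last.
- by move=> t _; rewrite derive1E; case: (dF t).
- split; [by move=> t _; case: (dF t)|exact: cvg_at_right_filter (cF 0)|
    exact: cvg_at_left_filter (cF pi)].
- exact: continuous_subspaceT cf.
- exact: pi_gt0.
rewrite /F /= !fctE sin0 sinpi !mul0r !scaler0 !addr0 subr0 /GRing.scale/=.
have p0 : (pi : R) != 0 by rewrite gt_eqF// pi_gt0.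
by rewrite [X in _ * X]mulrC mulKf.
Qed.

End averages.

(** * Taylor expansion of a real power *)

Section binomial_series.
Context {R : realType}.

(** Generalized binomial coefficient [a (a-1) ... (a-k+1) / k!]. *)
Fixpoint gbin (a : R) (k : nat) : R :=
  if k is k'.+1 then a / k%:R * gbin (a - 1) k' else 1.

(** The binomial series of [(1 + x)^a], truncated to degree less than [n]. *)
Definition binpoly (n : nat) (a : R) : {poly R} := \poly_(k < n) gbin a k.

Lemma deriv_binpoly n a : (binpoly n.+1 a)^`() = a *: binpoly n (a - 1).
Proof.
apply/polyP => k; rewrite coef_deriv coefZ !coef_poly ltnS.
case: ifP => _; last by rewrite mul0rn mulr0.
rewrite /= -[LHS]mulr_natr mulrAC -[a / _ * _]mulrA mulVf ?mulr1//.
Qed.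

(** The remainder of the binomial series.  The derivative of the remainder of
    order [n + 1] for the exponent [a] is [a] times that of order [n] for
    [a - 1], so induction on the order and the mean value theorem apply. *)
Lemma taylor_powR n (a : R) : exists2 K, 0 <= K &
  forall x, `|x| <= 1 / 2 ->
    `|(1 + x) `^ a - (binpoly n a).[x]| <= K * `|x| ^+ n.
Proof.
elim: n a => [|n IH] a.
  exists ((1 / 2) `^ a + (3 / 2) `^ a); first by rewrite addr_ge0// powR_ge0.
  move=> x; rewrite ler_norml => /andP[x1 x2].
  rewrite (_ : binpoly 0 a = 0); last first.
    by apply/polyP => k; rewrite coef_poly coef0.
  rewrite horner0 subr0 expr0 mulr1 ger0_norm ?powR_ge0//.
  have [a0|a0] := leP 0 a.
    rewrite -[leLHS]add0r lerD ?powR_ge0// ge0_ler_powR// ?nnegrE; lra.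
  rewrite -[leLHS]addr0 lerD ?powR_ge0//.
  have e (y : R) : y `^ a = (y `^ (- a))^-1 by rewrite powRN invrK.
  have p1 : 0 < 1 + x by lra.
  have p2 : 0 < 1 / 2 :> R by lra.
  rewrite !e lef_pV2 ?posrE ?powR_gt0//.
  rewrite ge0_ler_powR// ?nnegrE ?oppr_ge0; [exact: ltW..|lra].
have [K K0 HK] := IH (a - 1).
exists (`|a| * K); first by rewrite mulr_ge0.
pose g y : R := (1 + y) `^ a - (binpoly n.+1 a).[y].
pose dg y : R := a * ((1 + y) `^ (a - 1) - (binpoly n (a - 1)).[y]).
have gdg y : `|y| <= 1 / 2 -> is_derive y (1:R) g (dg y).
  rewrite ler_norml => /andP[y1 y2].
  have y0 : 0 < 1 + y by lra.
  have d1 : is_derive y (1:R) (fun z => 1 + z : R) (0 + 1).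
    exact: is_deriveD.
  have d2 := is_derive1_powR a y0.
  have d3 := is_derive1_comp d2 d1.
  apply: (is_derive_eq (is_deriveB d3 (is_derive_poly (binpoly n.+1 a) y))).
  by rewrite /dg deriv_binpoly hornerZ add0r mulr1 mulrBr.
have g0 : g 0 = 0.
  rewrite /g addr0 powR1 horner_coef0 coef_poly/=; exact: subrr.
have key x y : `|x| <= 1 / 2 -> `|y| <= `|x| -> 
   `|dg y * x| <= `|a| * K * `|x| ^+ n.+1.
  move=> x12 yx; rewrite /dg !normrM exprSr mulrA ler_wpM2r// -mulrA.
  rewrite ler_wpM2l//.
  apply: (le_trans (HK _ (le_trans yx x12))).
  by rewrite ler_wpM2l// lerXn2r// nnegrE.
have cg (u v : R) : `|u| <= 1 / 2 -> `|v| <= 1 / 2 ->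
    {within `[u, v], continuous g}.
  move=> hu hv; apply: derivable_within_continuous => y.
  rewrite in_itv/= => /andP[y1 y2]; case: (gdg y) => //.
  move: hu hv; rewrite !ler_norml => /andP[? ?] /andP[? ?].
  by apply/andP; split; lra.
move=> x x12; rewrite -/(g x).
have o12 : `|0 : R| <= 1 / 2 by rewrite normr0; lra.
have [x0|x0] := leP 0 x.
  have dg' y : y \in `]0, x[%R -> is_derive y (1:R) g (dg y).
    rewrite in_itv/= => /andP[y1 y2]; apply: gdg.
    by rewrite gtr0_norm// (le_trans (ltW y2))// (le_trans _ x12)// ler_norm.
  have [c] := MVT_segment x0 dg' (cg _ _ o12 x12).
  rewrite in_itv/= g0 !subr0 => /andP[c0 cx] ->.
  by apply: key => //; rewrite !ger0_norm.
have dg' y : y \in `]x, 0[%R -> is_derive y (1:R) g (dg y).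
  rewrite in_itv/= => /andP[y1 y2]; apply: gdg.
  by rewrite ltr0_norm// (le_trans _ x12)// ltr0_norm// lerN2 ltW.
have [c] := MVT_segment (ltW x0) dg' (cg _ _ x12 o12).
rewrite in_itv/= g0 !sub0r => /andP[cx c0] /eqP; rewrite eqr_oppLR => /eqP ->.
rewrite mulrN opprK; apply: key => //.
by rewrite !ler0_norm ?lerN2// ltW.
Qed.

End binomial_series.

(** * Functions of the angle as elements of H^1 *)

Section zonal.
Context {R : realType} (d : nat).
Local Notation E := ('rV[R]_2 * 'rV[R]_d.-1.+1)%type.
Local Notation cosang := (@cos_angle R d).
Local Notation r := (@Defs.radius R d).

Lemma continuous_cos_angle : continuous cosang.
Proof.
move=> z; apply: cvgMr; apply: (cvg_comp fst (fun x : 'rV[R]_2 => x ord0 ord0)).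
  exact: cvg_fst.
exact: coord_continuous.
Qed.

Lemma cos_angleD (z w : E) : cosang (z + w) = cosang z + cosang w.
Proof. by rewrite /cos_angle/= mxE mulrDr. Qed.

Lemma cos_angleZ (a : R) (z : E) : cosang (a *: z) = a * cosang z.
Proof. by rewrite /cos_angle/= mxE mulrCA. Qed.

Lemma horner_direction (p : {poly R}) (x w : R) :
  is_derive x w (horner p) (p^`().[x] * w).
Proof.
have dp : differentiable (horner p) x.
  exact/derivable1_diffP/derivable_horner.
apply: DeriveDef; first exact: diff_derivable.
have [_ <-] := is_derive_poly p x.
rewrite !deriveE// -[in LHS](mulr1 w) -[w * 1]/(w *: (1 : R)) linearZ/=.
by rewrite mulrC.
Qed.

Lemma is_derive_cos_angle (p : {poly R}) (z v : E) :
  is_derive z v (fun z => p.[cosang z]) (p^`().[cosang z] * cosang v).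
Proof.
have [dp Dp] := horner_direction p (cosang z) (cosang v).
(* By linearity of [cosang] the two difference quotients coincide. *)
have q : (fun h : R => h^-1 *:
      (((fun z => p.[cosang z]) \o shift z) (h *: v) - p.[cosang z])) =
    (fun h : R => h^-1 *:
      ((horner p \o shift (cosang z)) (h *: cosang v) - p.[cosang z])).
  by apply/funext => h /=; rewrite cos_angleD cos_angleZ.
by apply: DeriveDef; rewrite /derivable /derive q.
Qed.

Lemma smooth_cos_angle (p : {poly R}) : smooth (fun z : E => p.[cosang z]).
Proof.
move=> k; elim: k p => [|k IH] p /=.
  move=> z; apply: (cvg_comp cosang (horner p)).
    exact: continuous_cos_angle.
  exact: continuous_horner.
move=> v; split; first by move=> z; have [] := is_derive_cos_angle p z v.
rewrite (_ : (fun z => _) = fun z => (cosang v *: p^`()).[cosang z]).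
  exact: IH.
apply/funext => z; have [_ ->] := is_derive_cos_angle p z v.
by rewrite hornerZ mulrC.
Qed.

(** On [M] this is the Riemannian gradient of [p (cos theta)].  The projection
    onto the tangent space is written without division by [dot z.1 z.1], which
    makes it visibly measurable. *)
Definition zonal_grad (p : {poly R}) (z : E) : E :=
  ((p^`().[cosang z] / r) *: (delta_mx ord0 ord0 - (cosang z / r) *: z.1), 0).

Lemma dot_delta (x : 'rV[R]_2) : dot (delta_mx ord0 ord0) x = x ord0 ord0.
Proof.
by rewrite /dot !big_ord_recl big_ord0 !mxE/= mul1r mul0r !addr0.
Qed.

Lemma grad_zonal (p : {poly R}) (z : E) : M z ->
  grad (fun z : E => p.[cosang z]) z = zonal_grad p z.
Proof.
move=> [s1 s2]; rewrite /grad /zonal_grad.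
set a := p^`().[cosang z].
have -> : \row_i 'D_(delta_mx ord0 i, 0) (fun z : E => p.[cosang z]) z =
   (a / r) *: delta_mx ord0 ord0 :> 'rV[R]_2.
  apply/rowP => i; rewrite !mxE.
  have [_ ->] := is_derive_cos_angle p z (delta_mx ord0 i, 0).
  by rewrite /cos_angle/= mxE eqxx/= mulrA eq_sym.
have -> : \row_i 'D_(0, delta_mx ord0 i) (fun z : E => p.[cosang z]) z = 0.
  apply/rowP => i; rewrite !mxE.
  have [_ ->] := is_derive_cos_angle p z (0, delta_mx ord0 i).
  by rewrite /cos_angle/= mxE !mulr0.
have dot0 n (x : 'rV[R]_n) : dot 0 x = 0.
  by rewrite /dot big1// => i _; rewrite mxE mul0r.
rewrite /tproj dot0 mul0r scale0r subr0; congr (_, _).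
have -> : dot ((a / r) *: delta_mx ord0 ord0) z.1 = a / r * z.1 ord0 ord0.
  rewrite -dot_delta /dot big_distrr/=; apply: eq_bigr => i _.
  by rewrite !mxE mulrA.
rewrite (s1 : dot z.1 z.1 = r ^+ 2) scalerBr scalerA; congr (_ - _ *: _).
rewrite /cos_angle expr2 invfM; ring.
Qed.

Hypothesis hd : (3 <= d)%N.

Lemma radiusV2 : r^-1 ^+ 2 = d%:R - 2.
Proof. by rewrite /radius invrK sqr_sqrtr// ltW// dB2_gt0. Qed.

Lemma sqnorm_zonal_grad (p : {poly R}) (z : E) : M z ->
  sqnorm (zonal_grad p z) =
  (d%:R - 2) * p^`().[cosang z] ^+ 2 * (1 - cosang z ^+ 2).
Proof.
move=> [s1 s2]; rewrite /sqnorm /zonal_grad/=.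
rewrite dotZ exprMn radiusV2.
rewrite (_ : dot 0 0 = 0) ?addr0; last first.
  by rewrite /dot big1// => i _; rewrite mxE mul0r.
rewrite [_ ^+ 2 * (_ - 2)]mulrC; congr (_ * _).
have r0 : r != 0 by rewrite gt_eqF// radius_gt0.
have cE : z.1 ord0 ord0 = r * cosang z by rewrite mulVKf.
rewrite {1}/dot !big_ord_recl !big_ord0 !mxE/= !addr0 !cE.
rewrite -[LHS](_ : 1 - 2 * cosang z ^+ 2 +
    (cosang z / r) ^+ 2 * (dot z.1 z.1) = _).
  by rewrite (s1 : dot z.1 z.1 = r ^+ 2); field.
by rewrite /dot !big_ord_recl !big_ord0/= !addr0 !cE; field.
Qed.

Lemma measurable_horner_cos_angle (p : {poly R}) :
  measurable_fun setT (fun z : E => p.[cosang z]).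
Proof.
apply: (measurableT_comp (f := horner p)); last exact: measurable_cos_angle.
by apply: continuous_measurable_fun; exact: continuous_horner.
Qed.

Lemma measurable_zonal_grad (p : {poly R}) : measurable_fun setT (zonal_grad p).
Proof.
apply/measurable_fun_pairP; split; last exact: measurable_cst.
apply: measurable_fun_rVP => i.
have -> : (fun x => ((fst \o zonal_grad p) x) ord0 i) =
  (fun z : E => p^`().[cosang z] / r *
     ((delta_mx ord0 ord0 : 'rV[R]_2) ord0 i - cosang z / r * z.1 ord0 i)).
  by apply/funext => z; rewrite /= !mxE.
apply: measurable_funM.
  by apply: measurable_funM => //; exact: measurable_horner_cos_angle.
apply: measurable_funB => //; apply: measurable_funM.
  by apply: measurable_funM => //; exact: measurable_cos_angle.
exact: (measurableT_comp (measurable_rV_coord i)).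
Qed.

Let zonal_approx (p : {poly R}) : exists phi : nat -> E -> R,
  [/\ forall k, smooth (phi k),
     (\int[vol d]_(z in @M R d) ((phi k z - p.[cosang z]) ^+ 2)%:E)%E
       @[k --> \oo] --> 0%E
   & (\int[vol d]_(z in @M R d) (sqnorm (grad (phi k) z - zonal_grad p z))%:E)%E
       @[k --> \oo] --> 0%E].
Proof.
exists (fun _ z => p.[cosang z]); split.
- by move=> _; exact: smooth_cos_angle.
- under eq_fun do under eq_integral do rewrite subrr expr0n/=.
  by rewrite integral0; exact: cvg_cst.
- rewrite (_ : (fun k => _) = cst 0%E); first exact: cvg_cst.
  apply/funext => k /=; apply: integral0_eq => z Mz.
  rewrite grad_zonal// subrr /sqnorm /dot/=.
  by rewrite !big1 ?addr0// => i _; rewrite mxE mul0r.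
Qed.

(** The element [p (cos theta)] of H^1; it is smooth, so the approximating
    sequence is constant. *)
Definition zonal (p : {poly R}) : H1 R d :=
  MkH1 (measurable_funTS (measurable_horner_cos_angle p))
    (measurable_funTS (measurable_zonal_grad p)) (zonal_approx p).

End zonal.

(** * Norms of functions of the angle *)

Section zonal_norms.
Context {R : realType} (d : nat).
Hypothesis hd : (3 <= d)%N.
Local Notation cosang := (@cos_angle R d).
Local Notation A := ((d%:R - 2) ^+ 2 / 4 : R).
Local Notation V := (VolM d : R).

(** The statement is about an arbitrary [u] with the right value and gradient,
    so as to cover both [zonal d p] and its translates by constants. *)
Lemma norm_H1_zonal (u : H1 R d) (p : {poly R}) :
  (forall z, u z = p.[cosang z]) -> H1grad u = zonal_grad p ->
  norm_H1 u ^+ 2 = V * avg (fun c =>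
    (d%:R - 2) * p^`().[c] ^+ 2 * (1 - c ^+ 2) + A * p.[c] ^+ 2).
Proof.
move=> up gup; rewrite /norm_H1 sqr_sqrtr; last first.
  apply: Rintegral_ge0 => z Mz; rewrite addr_ge0//.
    by rewrite addr_ge0// sumr_ge0// => i _; rewrite -expr2 sqr_ge0.
  by rewrite mulr_ge0 ?sqr_ge0// divr_ge0 ?sqr_ge0.
rewrite -(Rintegral_cos_angle hd); last first.
  pose P := (d%:R - 2)%:P * p^`() ^+ 2 * (1 - 'X ^+ 2) + A%:P * p ^+ 2.
  rewrite (_ : (fun c => _) = horner P); first exact: continuous_horner.
  by apply/funext => c; rewrite /P !hornerE.
apply: eq_Rintegral => z; rewrite inE => Mz.
by rewrite gup sqnorm_zonal_grad// up.
Qed.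

Lemma mean_zonal (p : {poly R}) : mean (zonal d p) = avg (horner p).
Proof.
rewrite /mean (Rintegral_cos_angle hd); last exact: continuous_horner.
by rewrite mulKf// gt_eqF// VolM_gt0.
Qed.

Lemma norm_Lq_zonal (q : R) (p : {poly R}) : 1 <= q ->
  norm_Lq q (zonal d p) = (V * avg (fun c => `|p.[c]| `^ q)) `^ q^-1.
Proof.
move=> q1; rewrite /norm_Lq -(Rintegral_cos_angle hd)// => c.
apply: (cvg_comp (horner p) (fun x : R => `|x| `^ q)).
  exact: continuous_horner.
exact: continuous_normr_powR.
Qed.

Lemma nonconstant_zonal (p : {poly R}) :
  avg (fun c => (p.[c] - avg (horner p)) ^+ 2) != 0 -> nonconstant (zonal d p).
Proof.
move=> np [k pk]; case/negP: np; apply/eqP.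
have V0 : V != 0 by rewrite gt_eqF// VolM_gt0.
have mM := @measurable_M R d.
have cp := @continuous_horner R p.
have kE : avg (horner p) = k.
  apply: (mulfI V0); rewrite -(Rintegral_cos_angle hd)//.
  rewrite -[RHS]mulrC -(Rintegral_cst _ mM) /Rintegral.
  congr fine; apply: ae_eq_integral => //.
  - apply/measurable_EFinP/measurable_funTS.
    exact: measurable_horner_cos_angle.
  - by apply: filterS pk => z /[apply] /= ->.
rewrite kE; apply: (mulfI V0).
rewrite mulr0 -(Rintegral_cos_angle hd); last first.
  rewrite (_ : (fun c => _) = horner ((p - k%:P) ^+ 2)).
    exact: continuous_horner.
  by apply/funext => c; rewrite !hornerE.
transitivity (\int[vol d]_(z in @M R d) (0 : R)); last first.
  by rewrite Rintegral_cst// mul0r.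
congr fine; apply: ae_eq_integral => //.
  apply/measurable_EFinP/measurable_funTS/measurable_funX/measurable_funB => //.
  exact: measurable_horner_cos_angle.
by apply: filterS pk => z /[apply] /= ->; rewrite subrr expr0n.
Qed.

End zonal_norms.

(** * The trial functions *)

Section test_functions.
Context {R : realType}.
Implicit Types (m lam eps beta b q : R).

(** [lam (m + eps x + beta (2 x^2 - 1))]; at [x = cos theta] this is
    [lam (m + eps cos theta + beta cos (2 theta))]. *)
Definition trial m lam eps beta : {poly R} :=
  (lam * (m - beta))%:P + (lam * eps) *: 'X + (2 * lam * beta) *: 'X^2.

Lemma trialE m lam eps beta c : (trial m lam eps beta).[c] =
  lam * (m + eps * c + beta * (2 * c ^+ 2 - 1)).
Proof. by rewrite /trial !hornerD hornerC !hornerZ hornerX hornerXn; ring. Qed.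

Lemma deriv_trial m lam eps beta c : (trial m lam eps beta)^`().[c] =
  lam * (eps + 4 * beta * c).
Proof.
rewrite /trial !derivD derivC !derivZ derivX derivXn add0r.
by rewrite hornerD !hornerZ hornerC hornerMn hornerXn/=; ring.
Qed.

Lemma avg_trial m lam eps beta : avg (horner (trial m lam eps beta)) = lam * m.
Proof.
rewrite (_ : horner _ = fun c => lam * (m - beta) + lam * eps * c
  + 2 * lam * beta * c ^+ 2 + 0 * c ^+ 3 + 0 * c ^+ 4); last first.
  by apply/funext => c; rewrite trialE; ring.
by rewrite avg_poly4; field.
Qed.

Lemma avg_trial2 m lam eps beta :
  avg (fun c => (trial m lam eps beta).[c] ^+ 2) =
  lam ^+ 2 * (m ^+ 2 + eps ^+ 2 / 2 + beta ^+ 2 / 2).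
Proof.
rewrite (_ : (fun c => _) = fun c => lam ^+ 2 * (m - beta) ^+ 2
  + 2 * lam ^+ 2 * eps * (m - beta) * c
  + lam ^+ 2 * (eps ^+ 2 + 4 * beta * (m - beta)) * c ^+ 2
  + 4 * lam ^+ 2 * eps * beta * c ^+ 3
  + 4 * lam ^+ 2 * beta ^+ 2 * c ^+ 4); last first.
  by apply/funext => c; rewrite trialE; ring.
by rewrite avg_poly4; field.
Qed.

Lemma avg_trial_energy D A m lam eps beta :
  avg (fun c => D * (trial m lam eps beta)^`().[c] ^+ 2 * (1 - c ^+ 2)
     + A * (trial m lam eps beta).[c] ^+ 2) =
  lam ^+ 2 * (D * (eps ^+ 2 / 2 + 2 * beta ^+ 2)
     + A * (m ^+ 2 + eps ^+ 2 / 2 + beta ^+ 2 / 2)).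
Proof.
rewrite (_ : (fun c => _) = fun c =>
  lam ^+ 2 * (D * eps ^+ 2 + A * (m - beta) ^+ 2)
  + lam ^+ 2 * (8 * D * eps * beta + 2 * A * eps * (m - beta)) * c
  + lam ^+ 2 * (D * (16 * beta ^+ 2 - eps ^+ 2)
      + A * (eps ^+ 2 + 4 * beta * (m - beta))) * c ^+ 2
  + lam ^+ 2 * (A * 4 * eps * beta - 8 * D * eps * beta) * c ^+ 3
  + lam ^+ 2 * (A * 4 * beta ^+ 2 - 16 * D * beta ^+ 2) * c ^+ 4); last first.
  by apply/funext => c; rewrite trialE deriv_trial; ring.
by rewrite avg_poly4; field.
Qed.

(** The average of [|1 + eps cos theta + eps^2 b cos (2 theta)|^q]. *)
Definition Lq_avg q b eps : R :=
  avg (fun c => `|(trial 1 1 eps (eps ^+ 2 * b)).[c]| `^ q).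

(** The coefficients of [eps^2] and [eps^4] in the expansion of [Lq_avg]. *)
Definition Lq_coef2 q : R := gbin q 2 / 2.
Definition Lq_coef4 q b : R :=
  gbin q 2 * b ^+ 2 / 2 + 3 / 4 * gbin q 3 * b + 3 / 8 * gbin q 4.

Lemma continuous_trial_powR q m lam eps beta : 1 <= q ->
  continuous (fun c => `|(trial m lam eps beta).[c]| `^ q).
Proof.
move=> q1 c.
apply: (cvg_comp (horner (trial m lam eps beta)) (fun x : R => `|x| `^ q)).
  exact: continuous_horner.
exact: continuous_normr_powR.
Qed.

Lemma binpoly5E q x : (binpoly 5 q).[x] =
  1 + gbin q 1 * x + gbin q 2 * x ^+ 2 + gbin q 3 * x ^+ 3 + gbin q 4 * x ^+ 4.
Proof.
rewrite horner_poly !big_ord_recr big_ord0; apply: etrans.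
  exact: (congr1 (fun y => y + _ + _ + _ + _) (add0r _)).
by rewrite -[gbin q 0]/1 mul1r.
Qed.

(** With [g = b cos (2 theta)] and [h = eps cos theta + eps^2 g], expand
    [(1 + h)^q] to fourth order in [h], drop the powers of [eps] above the
    fourth, and average; the odd powers of [eps] average to zero. *)
Lemma Lq_avg_expansion q b : 1 <= q -> `|b| <= 1 / 2 -> exists2 K, 0 <= K &
  forall eps, 0 < eps -> eps <= 1 / 4 ->
  `|Lq_avg q b eps - (1 + Lq_coef2 q * eps ^+ 2 + Lq_coef4 q b * eps ^+ 4)|
    <= K * eps ^+ 5.
Proof.
move=> q1 b12; have [K K0 HK] := taylor_powR 5 q.
exists (K * 2 ^+ 5 + (`|gbin q 3| * 4 + `|gbin q 4| * 15)).
  by rewrite addr_ge0 ?mulr_ge0 ?exprn_ge0// addr_ge0// mulr_ge0.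
move=> e e0 e14.
pose g1 := gbin q 1; pose g2 := gbin q 2.
pose g3 := gbin q 3; pose g4 := gbin q 4.
(* [P] collects by powers of [cos theta] the terms of order at most 4 in [e]. *)
pose P : {poly R} := (1 - g1 * e ^+ 2 * b + g2 * e ^+ 4 * b ^+ 2)%:P
  + (g1 * e - 2 * g2 * e ^+ 3 * b) *: 'X
  + (2 * g1 * e ^+ 2 * b + g2 * e ^+ 2 - 4 * g2 * e ^+ 4 * b ^+ 2
      - 3 * g3 * e ^+ 4 * b) *: 'X^2
  + (4 * g2 * e ^+ 3 * b + g3 * e ^+ 3) *: 'X^3
  + (4 * g2 * e ^+ 4 * b ^+ 2 + 6 * g3 * e ^+ 4 * b + g4 * e ^+ 4) *: 'X^4.
have hP c : P.[c] = (1 - g1 * e ^+ 2 * b + g2 * e ^+ 4 * b ^+ 2)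
  + (g1 * e - 2 * g2 * e ^+ 3 * b) * c
  + (2 * g1 * e ^+ 2 * b + g2 * e ^+ 2 - 4 * g2 * e ^+ 4 * b ^+ 2
      - 3 * g3 * e ^+ 4 * b) * c ^+ 2
  + (4 * g2 * e ^+ 3 * b + g3 * e ^+ 3) * c ^+ 3
  + (4 * g2 * e ^+ 4 * b ^+ 2 + 6 * g3 * e ^+ 4 * b + g4 * e ^+ 4) * c ^+ 4.
  by rewrite /P !hornerD hornerC !hornerZ hornerX !hornerXn.
have -> : 1 + Lq_coef2 q * e ^+ 2 + Lq_coef4 q b * e ^+ 4 = avg (horner P).
  have -> : horner P = _ := funext hP.
  rewrite avg_poly4 /Lq_coef2 /Lq_coef4 -/g2 -/g3 -/g4.
  by field.
apply: avg_dist;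
  [exact: continuous_trial_powR|exact: continuous_horner|move=> c c1].
rewrite trialE mul1r.
set g := b * (2 * c ^+ 2 - 1).
set h := e * c + e ^+ 2 * g.
have -> : 1 + e * c + e ^+ 2 * b * (2 * c ^+ 2 - 1) = 1 + h.
  by rewrite /h /g; ring.
have e1 : `|e| <= 1 by rewrite gtr0_norm//; lra.
have c21 : c ^+ 2 <= 1 by rewrite -real_normK ?num_real// exprn_ile1.
have g11 : `|g| <= 1.
  rewrite /g normrM (le_trans (ler_pM _ _ b12 (_ : _ <= 1))) ?mul1r//; last lra.
  by rewrite ler_norml; have := sqr_ge0 c; move=> ?; apply/andP; split; lra.
have h2e : `|h| <= 2 * e.
  rewrite (le_trans (ler_normD _ _))// normrM [X in _ + X]normrM normrX.
  rewrite (gtr0_norm e0).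
  have : e * `|c| <= e by rewrite ler_piMr// ltW.
  have : e ^+ 2 * `|g| <= e.
    rewrite (le_trans (ler_wpM2l (sqr_ge0 _) g11))// mulr1 expr2.
    by rewrite ler_piMr//; lra.
  lra.
have h12 : `|h| <= 1 / 2 by lra.
have -> : `|1 + h| = 1 + h.
  by rewrite ger0_norm//; move: h12; rewrite ler_norml => /andP[? ?]; lra.
rewrite -(subrKA (binpoly 5 q).[h]) (le_trans (ler_normD _ _))// mulrDl lerD//.
  rewrite (le_trans (HK _ h12))// -mulrA ler_wpM2l//.
  by rewrite -exprMn lerXn2r// ?nnegrE// mulr_ge0// ltW.
have -> : (binpoly 5 q).[h] - P.[c] = e ^+ 5 * (
    g3 * (3 * (c * g ^+ 2) + e * g ^+ 3)
  + g4 * (4 * (c ^+ 3 * g) + 6 * (e * (c ^+ 2 * g ^+ 2))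
     + 4 * (e ^+ 2 * (c * g ^+ 3)) + e ^+ 3 * g ^+ 4)).
  rewrite binpoly5E hP /h /g -/g1 -/g2 -/g3 -/g4; ring.
rewrite normrM gtr0_norm ?exprn_gt0// mulrC; apply: ler_wpM2r.
  by rewrite exprn_ge0// ltW.
have le1X (x : R) n : `|x| <= 1 -> `|x ^+ n| <= 1.
  by move=> x1; rewrite normrX exprn_ile1.
have le1M (x y : R) : `|x| <= 1 -> `|y| <= 1 -> `|x * y| <= 1.
  by move=> x1 y1; rewrite normrM mulr_ile1.
have b1 : `|c * g ^+ 2| <= 1 := le1M _ _ c1 (le1X _ _ g11).
have b2 : `|e * g ^+ 3| <= 1 := le1M _ _ e1 (le1X _ _ g11).
have b3 : `|c ^+ 3 * g| <= 1 := le1M _ _ (le1X _ _ c1) g11.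
have b4 : `|e * (c ^+ 2 * g ^+ 2)| <= 1 :=
  le1M _ _ e1 (le1M _ _ (le1X _ _ c1) (le1X _ _ g11)).
have b5 : `|e ^+ 2 * (c * g ^+ 3)| <= 1 :=
  le1M _ _ (le1X _ _ e1) (le1M _ _ c1 (le1X _ _ g11)).
have b6 : `|e ^+ 3 * g ^+ 4| <= 1 := le1M _ _ (le1X _ _ e1) (le1X _ _ g11).
apply: (le_trans (ler_normD _ _)).
apply: lerD; rewrite normrM ler_wpM2l// ler_norml; move: b1 b2 b3 b4 b5 b6;
  rewrite !ler_norml => /andP[? ?] /andP[? ?] /andP[? ?] /andP[? ?];
  by move=> /andP[? ?] /andP[? ?]; apply/andP; split; lra.
Qed.

End test_functions.

(** * The expansion along a sequence of small perturbations *)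

Section asymptotics.
Context {R : realType}.
Variable q : R.
Hypotheses (q2 : 2 < q) (q6 : q <= 6).

Lemma cvg_dist_le (u v : nat -> R) (l : R) :
  (\forall n \near \oo, `|u n - l| <= v n) -> v n @[n --> \oo] --> (0 : R) ->
  u n @[n --> \oo] --> l.
Proof.
move=> uv v0; apply/cvgrPdist_le => e e0.
near=> n; rewrite distrC.
have uvn : `|u n - l| <= v n by near: n.
have ve : `|v n| <= e by near: n; exact: (cvgr0_norm_le _ v0 _ e0).
by rewrite (le_trans uvn)// (le_trans _ ve)// ler_norm.
Unshelve. all: by end_near. Qed.

Lemma cvgrX (u : nat -> R) (l : R) k :
  u n @[n --> \oo] --> l -> u n ^+ k @[n --> \oo] --> l ^+ k.
Proof.
move=> ul; apply: (cvg_comp u (fun x => x ^+ k) ul).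
exact: exprn_continuous.
Qed.

Lemma cvg_sqrt (v : nat -> R) (l : R) :
  v n @[n --> \oo] --> l -> Num.sqrt (v n) @[n --> \oo] --> Num.sqrt l.
Proof.
by move=> vl; apply: (cvg_comp v Num.sqrt vl); exact: sqrt_continuous.
Qed.

(** The small parameter.  Starting at 1/4 keeps the perturbation of the
    constant 1 at most 1/2, where [taylor_powR] applies. *)
Definition eps (n : nat) : R := n.+4%:R^-1.

Lemma eps_gt0 n : 0 < eps n.
Proof. by rewrite invr_gt0 ltr0n. Qed.

Lemma eps_le n : eps n <= 1 / 4.
Proof. by rewrite mul1r lef_pV2 ?posrE ?ltr0n// ler_nat. Qed.

Lemma cvg_eps : eps n @[n --> \oo] --> (0 : R).
Proof.
have := @cvg_harmonic R; rewrite -(cvg_shiftn 3).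
by under eq_fun do rewrite /harmonic addn3.
Qed.

(** The coefficient of [eps^2 cos (2 theta)] in the trial function.  Among all
    coefficients, this one makes the limit in [cvg_defect] smallest. *)
Definition second_mode : R := (q - 1) / 12.
Local Notation b := second_mode.

(** The squared H^1 norm of
    [1 + e cos theta + e^2 second_mode cos (2 theta)], divided by that of the
    constant 1. *)
Definition energy (e : R) : R :=
  1 + (q - 1) / 2 * e ^+ 2 + (4 * q - 7) / 2 * b ^+ 2 * e ^+ 4.

Local Notation N n := (Lq_avg q b (eps n)).

(* [N = 1 + Lq_coef2 eps^2 + Z eps^4 = 1 + W eps^2], and [T eps^4] is the error
   of the second-order expansion of [N^(2/q)] in [N - 1]. *)
Let Z n : R := (N n - 1 - Lq_coef2 q * eps n ^+ 2) / eps n ^+ 4.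
Let W n : R := Lq_coef2 q + Z n * eps n ^+ 2.
Let T n : R := (N n `^ (2 / q) - (binpoly 3 (2 / q)).[N n - 1]) / eps n ^+ 4.

Let e0 n : eps n != 0. Proof. by rewrite gt_eqF// eps_gt0. Qed.

Let cvg_epsX k : eps n ^+ k.+1 @[n --> \oo] --> (0 : R).
Proof.
by have := cvgrX (k := k.+1) cvg_eps; rewrite expr0n.
Qed.

Let cvgZ : Z n @[n --> \oo] --> Lq_coef4 q b.
Proof.
have q1 : 1 <= q by move: q2 => h; lra.
have b12 : `|b| <= 1 / 2.
  by move: q2 q6 => h1 h2; rewrite /second_mode ger0_norm; lra.
have [K K0 HK] := Lq_avg_expansion q1 b12.
apply: (@cvg_dist_le _ (fun n => K * eps n)).
  near=> n; rewrite -(@ler_pM2r _ (eps n ^+ 4)) ?exprn_gt0 ?eps_gt0//.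
  rewrite -mulrA -exprS -[X in _ * X]gtr0_norm ?exprn_gt0 ?eps_gt0// -normrM.
  apply: le_trans (HK _ (eps_gt0 n) (eps_le n)).
  rewrite mulrBl mulfVK ?expf_neq0// le_eqVlt; apply/orP; left.
  by apply/eqP; congr (`|_|); ring.
rewrite -[X in _ --> X](mulr0 K); apply: cvgM; [exact: cvg_cst|exact: cvg_eps].
Unshelve. all: by end_near. Qed.

Let NE n : N n - 1 = W n * eps n ^+ 2.
Proof. by rewrite /W /Z; field. Qed.

Let cvgW : W n @[n --> \oo] --> Lq_coef2 q.
Proof.
rewrite -[X in _ --> X]addr0 -[X in _ + X](mulr0 (Lq_coef4 q b)).
by apply: cvgD; [exact: cvg_cst|apply: cvgM => //; exact: cvg_epsX].
Qed.

Let cvgT : T n @[n --> \oo] --> (0 : R).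
Proof.
have [K K0 HK] := taylor_powR 3 (2 / q).
have N1 : (W n * eps n ^+ 2) @[n --> \oo] --> (0 : R).
  rewrite -[X in _ --> X](mulr0 (Lq_coef2 q)).
  by apply: cvgM => //; exact: cvg_epsX.
apply: (@cvg_dist_le _ (fun n => K * (`|W n| ^+ 3 * eps n ^+ 2))).
  have h : 0 < 1 / 2 :> R by lra.
  near=> n; rewrite subr0 -(@ler_pM2r _ (eps n ^+ 4)) ?exprn_gt0 ?eps_gt0//.
  rewrite -[X in `|_| * X]gtr0_norm ?exprn_gt0 ?eps_gt0// -normrM.
  rewrite mulfVK ?expf_neq0//.
  have := HK (N n - 1); rewrite addrCA subrr addr0 => /(_ _)/le_trans; apply.
    rewrite NE; near: n; exact: (cvgr0_norm_le _ N1 _ h).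
  rewrite NE normrM (ger0_norm (sqr_ge0 _)) le_eqVlt; apply/orP; left.
  by apply/eqP; ring.
rewrite -[X in _ --> X](mulr0 K); apply: cvgM; first exact: cvg_cst.
rewrite -[X in _ --> X](mulr0 (`|Lq_coef2 q| ^+ 3)).
apply: cvgM; last exact: cvg_epsX.
apply: cvgrX; exact: cvg_norm.
Unshelve. all: by end_near. Qed.

(** [|u|^2 - Y |u|_q^2] for the perturbation of size [eps n], divided by the
    squared H^1 norm of the constant 1. *)
Definition defect n : R := energy (eps n) - N n `^ (2 / q).

Let q0 : q != 0. Proof. by move: q2 => h; apply: lt0r_neq0; lra. Qed.

(** The terms of order [eps^2] cancel because
    [2 / q * Lq_coef2 q = (q - 1) / 2]. *)
Lemma cvg_defect :
  defect n / eps n ^+ 4 @[n --> \oo] --> (q - 1) * (q - 2) * (q + 2) / 48.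
Proof.
pose s := 2 / q.
have -> : (fun n => defect n / eps n ^+ 4) = (fun n =>
    (4 * q - 7) / 2 * b ^+ 2 + - s * Z n + - (s * (s - 1) / 2) * W n ^+ 2
    - T n).
  apply/funext => n; rewrite /defect /T /energy.
  have -> : (binpoly 3 (2 / q)).[N n - 1] =
      1 + s * (N n - 1) + s * (s - 1) / 2 * (N n - 1) ^+ 2.
    rewrite horner_poly !big_ord_recr big_ord0; apply: etrans.
      exact: (congr1 (fun y => y + _ + _) (add0r _)).
    by rewrite /s /=; field.
  rewrite NE; move: (e0 n) (N n `^ (2 / q)) => en y.
  rewrite /W /Lq_coef2 /= /s; move: (Z n) => z; field.
  by rewrite en q0.
have -> : (q - 1) * (q - 2) * (q + 2) / 48 = (4 * q - 7) / 2 * b ^+ 2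
    + - s * Lq_coef4 q b + - (s * (s - 1) / 2) * Lq_coef2 q ^+ 2 - 0.
  by rewrite /Lq_coef4 /Lq_coef2 /second_mode /s /=; field.
apply: cvgB => //; apply: cvgD; [apply: cvgD|].
- exact: cvg_cst.
- by apply: cvgM => //; exact: cvg_cst.
- by apply: cvgM; [exact: cvg_cst|exact: cvgrX].
Qed.

Lemma cvg_energy : energy (eps n) @[n --> \oo] --> (1 : R).
Proof.
have -> : 1 = 1 + (q - 1) / 2 * 0 + (4 * q - 7) / 2 * b ^+ 2 * 0 :> R by ring.
by apply: cvgD; [apply: cvgD|]; first exact: cvg_cst;
  apply: cvgM; (exact: cvg_cst || exact: cvg_epsX).
Qed.

Lemma cvg_variance :
  (energy (eps n) - 1) / eps n ^+ 2 @[n --> \oo] --> (q - 1) / 2.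
Proof.
have -> : (fun n => (energy (eps n) - 1) / eps n ^+ 2) =
    (fun n => (q - 1) / 2 + (4 * q - 7) / 2 * b ^+ 2 * eps n ^+ 2).
  by apply/funext => n; rewrite /energy; field.
rewrite [X in _ --> X](_ : _ =
  (q - 1) / 2 + (4 * q - 7) / 2 * b ^+ 2 * 0); last by ring.
by apply: cvgD; [exact: cvg_cst|apply: cvgM; [exact: cvg_cst|exact: cvg_epsX]].
Qed.

Lemma cvg_Lq_avg : N n `^ (2 / q) @[n --> \oo] --> (1 : R).
Proof.
have -> : (fun n => N n `^ (2 / q)) =
    (fun n => energy (eps n) - defect n / eps n ^+ 4 * eps n ^+ 4).
  by apply/funext => n; rewrite mulfVK ?expf_neq0// /defect opprB addrC subrK.
rewrite -[X in _ --> X]subr0.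
rewrite -[X in _ - X](mulr0 ((q - 1) * (q - 2) * (q + 2) / 48)).
apply: cvgB; first exact: cvg_energy.
by apply: cvgM; [exact: cvg_defect|exact: cvg_epsX].
Qed.

Lemma energy_gt1 e : 0 < e -> 1 < energy e.
Proof.
move=> e_gt0; rewrite /energy -addrA ltrDl.
have h2 := q2.
have h : 0 < (q - 1) / 2 * e ^+ 2 by rewrite mulr_gt0 ?exprn_gt0//; lra.
have h' : 0 <= (4 * q - 7) / 2 * b ^+ 2 * e ^+ 4.
  apply: mulr_ge0; last by rewrite exprn_ge0// ltW.
  by apply: mulr_ge0; [lra|exact: sqr_ge0].
lra.
Qed.

Lemma cvg_quotient :
  energy (eps n) * defect n / (energy (eps n) - 1) ^+ 2 @[n --> \oo] -->
  (q + 2) * (q - 2) / (12 * (q - 1)).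
Proof.
have -> : (fun n => energy (eps n) * defect n / (energy (eps n) - 1) ^+ 2) =
   (fun n => energy (eps n) * (defect n / eps n ^+ 4)
       * (((energy (eps n) - 1) / eps n ^+ 2) ^+ 2)^-1).
  apply/funext => n.
  have e1 : energy (eps n) - 1 != 0.
    by rewrite subr_eq0 gt_eqF// energy_gt1// eps_gt0.
  by field; rewrite e1 e0.
have h2 := q2.
have -> : (q + 2) * (q - 2) / (12 * (q - 1)) =
   1 * ((q - 1) * (q - 2) * (q + 2) / 48) * (((q - 1) / 2) ^+ 2)^-1 :> R.
  by field; apply: lt0r_neq0; lra.
apply: cvgM; first by apply: cvgM; [exact: cvg_energy|exact: cvg_defect].
apply: cvgV; last by apply: cvgrX; exact: cvg_variance.
by rewrite expf_neq0//; apply: lt0r_neq0; lra.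
Qed.

End asymptotics.

(** * The normalized trial sequence *)

Section sharpness.
Context {R : realType} (d : nat).
Hypothesis hd : (3 <= d)%N.
Local Notation A := ((d%:R - 2) ^+ 2 / 4 : R).
Local Notation V := (VolM d : R).
Local Notation Y := (Y R d).
Let q : R := 2 * d%:R / (d%:R - 2).
Local Notation b := (second_mode q).

Let D0 : 0 < d%:R - 2 :> R. Proof. exact: dB2_gt0. Qed.
Let D0' : d%:R - 2 != 0 :> R. Proof. by rewrite gt_eqF. Qed.
Let V0 : 0 < V. Proof. exact: VolM_gt0. Qed.
Let A0 : 0 < A. Proof. by rewrite divr_gt0// exprn_gt0. Qed.
Let d3 : 3 <= d%:R :> R. Proof. by rewrite ler_nat. Qed.
Let d0' : d%:R != 0 :> R.
Proof. by rewrite pnatr_eq0 -lt0n (leq_trans _ hd). Qed.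

Let q2 : 2 < q.
Proof. by rewrite /q ltr_pdivlMr//; move: d3 => h; lra. Qed.

Let q6 : q <= 6.
Proof. by rewrite /q ler_pdivrMr//; move: d3 => h; lra. Qed.

Let q1 : 1 <= q. Proof. by move: q2 => h; lra. Qed.
Let q0 : q != 0. Proof. by move: q2 => h; apply: lt0r_neq0; lra. Qed.

(* The eigenvalue [d - 2] of [cos theta] is [A (q - 2)]: this is what makes the
   second variation degenerate. *)
Let DA : d%:R - 2 = A * (q - 2).
Proof. by rewrite /q; field; rewrite D0'. Qed.

Let Y0 : 0 < Y. Proof. by rewrite mulr_gt0// powR_gt0. Qed.

Local Notation ener n := (energy q (eps n)).
Local Notation N n := (Lq_avg q b (eps n)).

Let ener_gt1 n : 1 < ener n. Proof. exact: (energy_gt1 q2 (eps_gt0 n)). Qed.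
Let ener_gt0 n : 0 < ener n. Proof. exact: lt_trans (ener_gt1 n). Qed.

(** The amplitude for which the squared H^1 norm is [Y]. *)
Definition amplitude n : R := Num.sqrt (V `^ (2 / d%:R) / (V * ener n)).
Local Notation lam := amplitude.

Let lam2 n : lam n ^+ 2 = V `^ (2 / d%:R) / (V * ener n).
Proof. by rewrite sqr_sqrtr// divr_ge0 ?powR_ge0// mulr_ge0// ltW. Qed.

Let lam_gt0 n : 0 < lam n.
Proof. by rewrite sqrtr_gt0 divr_gt0 ?powR_gt0// mulr_gt0. Qed.

(** The sequence along which the quotient tends to the sharp constant. *)
Definition trial_seq n : H1 R d :=
  zonal d (trial 1 (lam n) (eps n) (eps n ^+ 2 * b)).
Local Notation u := trial_seq.

(* The squared H^1 norm of the trial function, with [m = 1], and of its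
   deviation from the mean, with [m = 0]. *)
Let norm_shape (a D m lam e be : R) : D = a * (q - 2) -> be = e ^+ 2 * b ->
  V * (lam ^+ 2 * (D * (e ^+ 2 / 2 + 2 * be ^+ 2)
     + a * (m ^+ 2 + e ^+ 2 / 2 + be ^+ 2 / 2))) =
  a * V * lam ^+ 2 * (energy q e - 1 + m ^+ 2).
Proof. by move=> -> ->; rewrite /energy; field. Qed.

Lemma norm_trial n : norm_H1 (u n) ^+ 2 = Y.
Proof.
rewrite (norm_H1_zonal hd (p := trial 1 (lam n) (eps n) (eps n ^+ 2 * b)))//.
rewrite avg_trial_energy (norm_shape _ _ DA)// expr1n subrK lam2 /Defs.Y.
by field; rewrite !gt_eqF.
Qed.

Lemma mean_trial n : mean (u n) = lam n.
Proof. by rewrite mean_zonal// avg_trial mulr1. Qed.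

Lemma norm_trial_mean n :
  norm_H1 (H1_subc (u n) (mean (u n))) ^+ 2 = Y * (ener n - 1) / ener n.
Proof.
rewrite mean_trial.
rewrite (norm_H1_zonal hd (p := trial 0 (lam n) (eps n) (eps n ^+ 2 * b))).
- rewrite avg_trial_energy (norm_shape _ _ DA)// expr0n addr0 lam2 /Defs.Y.
  by field; rewrite !gt_eqF.
- by move=> z; rewrite /= !trialE; ring.
- apply/funext => z; rewrite /= /zonal_grad; congr (((_ / _) *: _), _).
  by rewrite !deriv_trial.
Qed.

Lemma nonconstant_trial n : nonconstant (u n).
Proof.
apply: nonconstant_zonal => //; rewrite avg_trial mulr1.
have -> : (fun c =>
    ((trial 1 (lam n) (eps n) (eps n ^+ 2 * b)).[c] - lam n) ^+ 2) = (fun c =>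
    (trial 0 (lam n) (eps n) (eps n ^+ 2 * b)).[c] ^+ 2).
  by apply/funext => c; rewrite !trialE; congr (_ ^+ 2); ring.
rewrite avg_trial2 expr0n add0r gt_eqF// mulr_gt0 ?exprn_gt0//.
by rewrite ltr_wpDr ?divr_ge0 ?sqr_ge0// divr_gt0// exprn_gt0// eps_gt0.
Qed.

Let N_ge0 n : 0 <= N n.
Proof.
apply: mulr_ge0; first by rewrite invr_ge0 pi_ge0.
by apply: Rintegral_ge0 => t _; exact: powR_ge0.
Qed.

Lemma norm_Lq_trial n : norm_Lq q (u n) ^+ 2 = N n `^ (2 / q) / ener n.
Proof.
rewrite norm_Lq_zonal//.
have -> : avg (fun c => `|(trial 1 (lam n) (eps n) (eps n ^+ 2 * b)).[c]| `^ q)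
   = lam n `^ q * N n.
  rewrite -avgZ; last exact: continuous_trial_powR.
  congr avg; apply/funext => c.
  rewrite -powRM ?(ltW (lam_gt0 n)) ?normr_ge0//; congr (_ `^ _).
  by rewrite !trialE mul1r normrM (gtr0_norm (lam_gt0 n)).
rewrite -powR_mulrn ?powR_ge0// -powRrM [q^-1 * 2]mulrC.
have V1 := ltW V0; have l1 := powR_ge0 (lam n) q.
rewrite (powRM _ V1 (mulr_ge0 l1 (N_ge0 n))) (powRM _ l1 (N_ge0 n)).
rewrite -[lam n `^ q `^ _]powRrM [q * _]mulrC mulfVK//.
rewrite (powR_mulrn _ (ltW (lam_gt0 n))) lam2.
have -> : V `^ (2 / q) = V / V `^ (2 / d%:R).
  have -> : 2 / q = 1 - 2 / d%:R by rewrite /q; field; rewrite d0' D0'.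
  by rewrite powRB ?(gt_eqF V0) ?implybT// powRr1.
by field; rewrite !gt_eqF// powR_gt0.
Qed.

Lemma deficit_trial n :
  norm_H1 (u n) ^+ 2 - Y * norm_Lq q (u n) ^+ 2 = Y * defect q n / ener n.
Proof.
by rewrite norm_trial norm_Lq_trial /defect; field; rewrite gt_eqF.
Qed.

Lemma quotient_trial n :
  norm_H1 (u n) ^+ 2 * (norm_H1 (u n) ^+ 2 - Y * norm_Lq q (u n) ^+ 2) /
    norm_H1 (H1_subc (u n) (mean (u n))) ^+ 4 =
  ener n * defect q n / (ener n - 1) ^+ 2.
Proof.
rewrite deficit_trial norm_trial (exprM _ 2 2) norm_trial_mean.
by field; rewrite !gt_eqF// subr_gt0.
Qed.

Lemma cvg_norm_Lq_trial : norm_Lq q (u n) @[n --> \oo] --> (1 : R).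
Proof.
have -> : (fun n => norm_Lq q (u n)) =
    (fun n => Num.sqrt (N n `^ (2 / q) / ener n)).
  by apply/funext => n; rewrite -norm_Lq_trial sqrtr_sqr ger0_norm// powR_ge0.
suff h : N n `^ (2 / q) / ener n @[n --> \oo] --> (1 / 1 : R).
  by have := cvg_sqrt h; rewrite divr1 sqrtr1.
apply: cvgM; first exact: cvg_Lq_avg.
by apply: cvgV; [exact: oner_neq0|exact: cvg_energy].
Qed.

Lemma liminf_quotient_trial :
  limn_einf (fun n =>
    (norm_H1 (u n) ^+ 2 * (norm_H1 (u n) ^+ 2 - Y * norm_Lq q (u n) ^+ 2) /
      norm_H1 (H1_subc (u n) (mean (u n))) ^+ 4)%:E) =
  ((q + 2) * (q - 2) / (12 * (q - 1)))%:E.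
Proof.
under eq_fun do rewrite quotient_trial.
have h : (ener n * defect q n / (ener n - 1) ^+ 2)%:E @[n --> \oo] -->
    ((q + 2) * (q - 2) / (12 * (q - 1)))%:E.
  by apply: cvg_EFin; [exact: nearW|exact: cvg_quotient].
by have [-> _] := cvg_limn_einf_sup h.
Qed.

Lemma cvg_norm_trial_mean :
  norm_H1 (H1_subc (u n) (mean (u n))) @[n --> \oo] --> (0 : R).
Proof.
have -> : (fun n => norm_H1 (H1_subc (u n) (mean (u n)))) =
   (fun n => Num.sqrt (Y * (ener n - 1) / ener n)).
  apply/funext => n; rewrite -norm_trial_mean sqrtr_sqr ger0_norm//.
  exact: sqrtr_ge0.
suff h : Y * (ener n - 1) / ener n @[n --> \oo] --> (Y * (1 - 1) / 1 : R).
  by have := cvg_sqrt h; rewrite subrr mulr0 mul0r sqrtr0.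
apply: cvgM; last by apply: cvgV; [exact: oner_neq0|exact: cvg_energy].
apply: cvgM; first exact: cvg_cst.
by apply: cvgB; [exact: cvg_energy|exact: cvg_cst].
Qed.

Lemma norm_trial_mean_gt0 n : 0 < norm_H1 (H1_subc (u n) (mean (u n))).
Proof.
have h : 0 < norm_H1 (H1_subc (u n) (mean (u n))) ^+ 2.
  by rewrite norm_trial_mean divr_gt0// mulr_gt0// subr_gt0.
rewrite lt_neqAle sqrtr_ge0 andbT; apply: contraTneq h => <-.
by rewrite expr0n ltxx.
Qed.

(** Divided by [w^alpha], where [w] is the norm of [u n] minus its mean, the
    inequality bounds a positive constant by [w^(4 - alpha)] times a bounded
    sequence, whereas [w] tends to 0. *)
Lemma no_lower_power (alpha c : R) : alpha < 4 -> 0 < c ->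
  ~ (forall n, c * norm_H1 (u n) `^ (2 - alpha) *
       norm_H1 (H1_subc (u n) (mean (u n))) `^ alpha
     <= norm_H1 (u n) ^+ 2 - Y * norm_Lq q (u n) ^+ 2).
Proof.
move=> a4 c0 H.
pose w n := norm_H1 (H1_subc (u n) (mean (u n))).
pose Q n := ener n * defect q n / (ener n - 1) ^+ 2.
pose k := c * Num.sqrt Y `^ (2 - alpha).
have k0 : 0 < k by rewrite mulr_gt0// powR_gt0// sqrtr_gt0.
have normE n : norm_H1 (u n) = Num.sqrt Y.
  by rewrite -(norm_trial n) sqrtr_sqr ger0_norm// sqrtr_ge0.
have le n : k <= Q n / Y * w n `^ (4 - alpha).
  have w0 : 0 < w n by exact: norm_trial_mean_gt0.
  rewrite -(ler_pM2r (powR_gt0 alpha w0)) -[leRHS]mulrA -powRD; last first.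
    by rewrite (gt_eqF w0) implybT.
  rewrite subrK (powR_mulrn _ (ltW w0)).
  move: (H n); rewrite {1}normE => Hn; apply: (le_trans Hn).
  rewrite /Q -quotient_trial norm_trial -/(w n).
  rewrite le_eqVlt; apply/orP; left; apply/eqP.
  by field; rewrite !gt_eqF.
have : Q n / Y * w n `^ (4 - alpha) @[n --> \oo] --> (0 : R).
  rewrite -[X in _ --> X](mulr0 ((q + 2) * (q - 2) / (12 * (q - 1)) / Y)).
  apply: cvgM.
    by apply: cvgM; [exact: cvg_quotient|exact: cvg_cst].
  have a4' : 0 < 4 - alpha by rewrite subr_gt0.
  apply: ((cvg_at_rightP _ _ _).1 (powR_cvg0 a4') w).
  by split; [exact: norm_trial_mean_gt0|exact: cvg_norm_trial_mean].
move=> /cvgr0_norm_lt /(_ _ k0) [m _ /(_ m (leqnn m))] /=.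
by rewrite ltNge (le_trans (le m))// ler_norm.
Qed.

End sharpness.

Theorem mainTheorem5 (R : realType) (d : nat) (hd : (3 <= d)%N) :
  let q : R := 2 * d%:R / (d%:R - 2) in
  (forall C : R, (q + 2) * (q - 2) / (12 * (q - 1)) < C ->
    ~ (forall u : nat -> H1 R d,
        (forall n, nonconstant (u n)) ->
        (forall n, norm_H1 (u n) ^+ 2 = Y R d) ->
        norm_Lq q (u n) @[n --> \oo] --> (1 : R) ->
        (C%:E <= limn_einf (fun n =>
          (norm_H1 (u n) ^+ 2 *
             (norm_H1 (u n) ^+ 2 - Y R d * norm_Lq q (u n) ^+ 2) /
           norm_H1 (H1_subc (u n) (mean (u n))) ^+ 4)%:E))%E)) /\
  (forall alpha : R, alpha < 4 ->
    ~ (exists c : R, 0 < c /\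
        forall u : H1 R d, nonconstant u ->
          c * norm_H1 u `^ (2 - alpha) *
              norm_H1 (H1_subc u (mean u)) `^ alpha
            <= norm_H1 u ^+ 2 - Y R d * norm_Lq q u ^+ 2)).
Proof.
move=> q; split=> [C qC H|alpha a4 [c [c0 H]]].
  have := H (@trial_seq R d) (nonconstant_trial hd) (norm_trial hd)
    (cvg_norm_Lq_trial hd).
  by rewrite liminf_quotient_trial// lee_fin leNgt qC.
by apply: (no_lower_power hd a4 c0) => n; apply: H; exact: nonconstant_trial.
Qed.
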